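(* Let $(\epsilon_1,\epsilon_2)\in\{+,-\}^2$, let $\mathfrak g={}^{\epsilon_1\epsilon_2}\widehat{\mathcal{SD}}$, $\xi\in\mathfrak g_0^*$, and $c=\xi(C)$. The irreducible highest weight module $L(\mathfrak g,\xi)$ is quasifinite if and only if there are nonzero polynomials $\alpha(w),\beta(w)\in\mathbb C[w]$, with - $\alpha$ odd and $\beta$ even if $(\epsilon_1,\epsilon_2)=(+,+)$, - $\alpha$ even and $\beta$ odd if $(\epsilon_1,\epsilon_2)=(+,-)$, - $\alpha$ and $\beta$ even if $(\epsilon_1,\epsilon_2)=(-,+)$, - $\alpha$ and $\beta$ odd if $(\epsilon_1,\epsilon_2)=(-,-)$, such that $$\beta\Big(\frac d{dx}\Big)\big(\Delta_0(x)\big)=0,$$ $$\alpha\Big(\frac d{dx}\Big)\Big((e^{x/2}+e^{-x/2})\Delta_0(x)\Big)+\alpha\Big(\frac d{dx}\Big)\Big((e^{x/2}-e^{-x/2})\Delta_1(x)-2c\Big)=0,$$ where $\Delta_0={}^{\epsilon_1\epsilon_2}\Delta_0$ and $\Delta_1={}^{\epsilon_1\epsilon_2}\Delta_1$.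
   Context: $\mathcal{SD}$ is the Lie superalgebra (supercommutator bracket) of the associative superalgebra over $\mathbb C$ generated by even $t^{\pm1}$, $D=t\frac{d}{dt}$ and odd $\theta,\partial_\theta$, with $f(D)t=tf(D+1)$, $\theta^2=\partial_\theta^2=0$, $\theta\partial_\theta+\partial_\theta\theta=1$, $\theta,\partial_\theta$ commuting with $t,D$. Put $M_0=\partial_\theta\theta$, $M_1=\theta\partial_\theta$, $M_+=\partial_\theta$, $M_-=\theta$, and $F(D)=\sum_{a=0,1,\pm}f_a(D)M_a$, $f_a\in\mathbb C[w]$ (similarly $G$). $\widehat{\mathcal{SD}}=\mathcal{SD}\oplus\mathbb CC$, $C$ central, is the central extension by the 2-cocycle $\Psi$ with $\Psi(t^rF(D),t^sG(D))=0$ if $r+s\ne0$ and, for $r=-s\ge0$, $$\Psi(t^rF(D),t^{s}G(D))=\sum_{-r\le j\le-1}\big(f_0(j)g_0(j+r)+f_+(j)g_-(j+r)-f_-(j)g_+(j+r)-f_1(j)g_1(j+r)\big),$$ extended to $r<0$ by super skew-symmetry. The principal $\frac12\mathbb Z$-gradation has weights $wt(C)=wt(D)=0$, $wt(t)=1$, $wt(\theta)=\frac12$, $wt(\partial_\theta)=-\frac12$. ${}^{\epsilon_1\epsilon_2}\mathcal{SD}=\{e\in\mathcal{SD}\mid\sigma(e)=-e\}$, where $\sigma$ is the linear map with $\sigma(XY)=(-1)^{|X||Y|}\sigma(Y)\sigma(X)$, $\sigma(t)=\epsilon_1t$, $\sigma(D)=-D-1$, $\sigma(\theta)=\epsilon_2\theta$,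 $\sigma(\partial_\theta)=-\epsilon_2\partial_\theta$; ${}^{\epsilon_1\epsilon_2}\widehat{\mathcal{SD}}={}^{\epsilon_1\epsilon_2}\mathcal{SD}\oplus\mathbb CC\subset\widehat{\mathcal{SD}}$, with the induced gradation. Its degree-$0$ part is abelian, spanned by $C$ and the elements $\partial_\theta\theta f(D)-\theta\partial_\theta f(-D-1)$, $f\in\mathbb C[w]$. For a $\frac12\mathbb Z$-graded Lie superalgebra $\mathfrak g$ with abelian $\mathfrak g_0$ and $\xi\in\mathfrak g_0^*$, $L(\mathfrak g,\xi)$ is the unique irreducible graded quotient of the $\mathfrak g$-module induced from the one-dimensional $\bigoplus_{j\ge0}\mathfrak g_j$-module on which $\mathfrak g_0$ acts by $\xi$ and $\mathfrak g_j$, $j>0$, acts by $0$. A graded module is quasifinite if all its graded subspaces are finite-dimensional. The generating series (formal power series in $x$, $\xi$ applied coefficientwise) are ${}^{\epsilon_1\epsilon_2}\Delta_0(x)=-\xi(\sinh(x(D+\tfrac12)))$ and ${}^{\epsilon_1\epsilon_2}\Delta_1(x)=-\xi((\theta\partial_\theta-\partial_\theta\theta)\cosh(x(D+\tfrac12)))$. *)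

(* Defs.v *)
From HB Require Import structures.
From mathcomp Require Import all_boot all_order all_algebra.
From mathcomp Require Import finmap.
From mathcomp Require Import monalg ring zify.

Set Implicit Arguments.
Unset Strict Implicit.
Unset Printing Implicit Defensive.

Import GRing.Theory.
Local Open Scope ring_scope.

(* The superalgebra generated by t^{+-1}, D, theta and d/dtheta, in normal form:
   finite sums of t^r F(D), where F = f_0 M_0 + f_1 M_1 + f_+ M_+ + f_- M_- is the
   2 x 2 matrix of polynomials with rows (f_0, f_+) and (f_-, f_1).
   Lemma monoE is the normal form, and the defining relations are proved below. *)
Record SD (K : fieldType) := MkSD { SDval : {malg 'M[{poly K}]_2 [int]} }.
HB.instance Definition _ (K : fieldType) := [isNew for @SDval K].
HB.instance Definition _ (K : fieldType) := [Choice of SD K by <:].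

Section SDZmodule.
Variable K : fieldType.
Implicit Types x y z : SD K.

Definition addSD x y := MkSD (SDval x + SDval y).
Definition oppSD x := MkSD (- SDval x).
Definition zeroSD : SD K := MkSD 0.

Let addSDA : associative addSD.
Proof. by move=> x y z; apply/val_inj/addrA. Qed.
Let addSDC : commutative addSD.
Proof. by move=> x y; apply/val_inj/addrC. Qed.
Let add0SD : left_id zeroSD addSD.
Proof. by move=> x; apply/val_inj/add0r. Qed.
Let addNSD : left_inverse zeroSD oppSD addSD.
Proof. by move=> x; apply/val_inj/addNr. Qed.

HB.instance Definition _ := GRing.isZmodule.Build (SD K) addSDA addSDC add0SD addNSD.

Lemma SDvalD : {morph @SDval K : x y / x + y}. Proof. by []. Qed.
Lemma SDval0 : SDval (0 : SD K) = 0. Proof. by []. Qed.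
End SDZmodule.

HB.lock Definition mono (K : fieldType) (r : int) (F : 'M[{poly K}]_2) : SD K :=
  MkSD << F *g r >>.

Definition coef (K : fieldType) (x : SD K) (r : int) : 'M[{poly K}]_2 := (SDval x)@_r.

HB.lock Definition lin_ext (K : fieldType) (V : zmodType)
    (h : int -> 'M[{poly K}]_2 -> V) (x : SD K) : V :=
  \sum_(r <- msupp (SDval x)) h r (coef x r).

Section SDAlgebra.
Variable K : fieldType.
Implicit Types (r s : int) (F G : 'M[{poly K}]_2) (x y z : SD K).

Lemma mono_def r F : mono r F = MkSD << F *g r >>.
Proof. by rewrite mono.unlock. Qed.

Lemma lin_extE (V : zmodType) (h : int -> 'M[{poly K}]_2 -> V) x :
  lin_ext h x = \sum_(r <- msupp (SDval x)) h r (coef x r).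
Proof. by rewrite lin_ext.unlock. Qed.

Lemma lin_extw (V : zmodType) (h : int -> 'M[{poly K}]_2 -> V) x (d : {fset int}) :
  (forall r, h r 0 = 0) -> (msupp (SDval x) `<=` d)%fset ->
  lin_ext h x = \sum_(r <- d) h r (coef x r).
Proof.
move=> h0 sxd; rewrite lin_extE (big_fset_incl _ sxd) // => r _ rx.
by rewrite /coef mcoeff_outdom.
Qed.

Lemma lin_extD (V : zmodType) (h : int -> 'M[{poly K}]_2 -> V) :
  (forall r, {morph h r : F G / F + G}) -> {morph lin_ext h : x y / x + y}.
Proof.
move=> hD x y.
have h0 r : h r 0 = 0 by apply: (addIr (h r 0)); rewrite -hD !add0r.
pose d := (msupp (SDval x) `|` msupp (SDval y))%fset.
rewrite (@lin_extw _ _ _ d) ?(@lin_extw _ h x d) ?(@lin_extw _ h y d) //.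
- by rewrite -big_split /=; apply: eq_bigr => r _; rewrite -hD /coef mcoeffD.
- exact: fsubsetUr.
- exact: fsubsetUl.
- exact: msuppD_le.
Qed.

Lemma lin_ext_mono (V : zmodType) (h : int -> 'M[{poly K}]_2 -> V) r F :
  h r 0 = 0 -> lin_ext h (mono r F) = h r F.
Proof.
move=> h0; rewrite lin_extE mono_def /coef msuppU.
case: eqP => [->|_]; first by rewrite big_seq_fset0.
by rewrite big_seq_fset1 mcoeffUU.
Qed.

Lemma monoD r : {morph @mono K r : F G / F + G}.
Proof. by move=> F G; rewrite !mono_def; apply/val_inj/monalgUD. Qed.

Lemma mono0 r : mono r 0 = 0 :> SD K.
Proof. by rewrite mono_def; apply/val_inj/monalgU0. Qed.

Lemma SD_eq x y : (forall r, coef x r = coef y r) -> x = y.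
Proof. by move=> h; apply/val_inj/malgP. Qed.

Lemma coefD r : {morph (@coef K)^~ r : x y / x + y}.
Proof. by move=> x y; apply: mcoeffD. Qed.

Lemma coef_mono r F s : coef (mono r F) s = F *+ (r == s).
Proof. by rewrite mono_def; apply: mcoeffU. Qed.

Lemma SD_ind (P : SD K -> Prop) :
  P 0 -> (forall x y, P x -> P y -> P (x + y)) ->
  (forall r F, P (mono r F)) -> forall x, P x.
Proof. move=> P0 PD PU x.
have -> : x = \sum_(r <- msupp (SDval x)) mono r (coef x r).
  apply/val_inj; rewrite /= (big_morph _ (@SDvalD K) (SDval0 K)).
  by rewrite [LHS]monalgE; apply: eq_bigr => r _; rewrite mono_def.
by apply: big_ind. Qed.

Definition scaleSD (c : K) x : SD K := lin_ext (fun r F => mono r (c%:P *: F)) x.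

Lemma coef_scaleSD c x r : coef (scaleSD c x) r = c%:P *: coef x r.
Proof.
have hD c' r' : {morph (fun F => mono r' (c'%:P *: F)) : F G / F + G}.
  by move=> F G; rewrite scalerDr monoD.
move: x; apply: SD_ind => [|x y hx hy|s F].
- by rewrite /scaleSD lin_extE SDval0 msupp0 big_seq_fset0 /coef mcoeff0 scaler0.
- by rewrite /scaleSD lin_extD // !coefD hx hy scalerDr.
- rewrite /scaleSD lin_ext_mono ?scaler0 ?mono0 // !coef_mono.
  by case: eqP; rewrite /= ?mulr1n ?mulr0n ?scaler0.
Qed.

Lemma scaleSDA a b x : scaleSD a (scaleSD b x) = scaleSD (a * b) x.
Proof. by apply: SD_eq => r; rewrite !coef_scaleSD scalerA polyCM. Qed.

Lemma scaleSD1 : left_id 1 scaleSD.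
Proof. by move=> x; apply: SD_eq => r; rewrite coef_scaleSD scale1r. Qed.

Lemma scaleSDDr : right_distributive scaleSD +%R.
Proof. by move=> a x y; apply: SD_eq => r; rewrite !(coef_scaleSD, coefD) scalerDr. Qed.

Lemma scaleSDDl x : {morph scaleSD^~ x : a b / a + b}.
Proof. by move=> a b; apply: SD_eq => r; rewrite !(coef_scaleSD, coefD) polyCD scalerDl. Qed.

HB.instance Definition _ := GRing.Zmodule_isLmodule.Build K (SD K)
  scaleSDA scaleSD1 scaleSDDr scaleSDDl.

Lemma coefZ c x r : coef (c *: x) r = c%:P *: coef x r.
Proof. exact: coef_scaleSD. Qed.

Lemma monoZ r c F : mono r (c%:P *: F) = c *: mono r F.
Proof.
apply: SD_eq => s; rewrite coefZ !coef_mono.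
by case: eqP; rewrite ?mulr1n ?mulr0n ?scaler0.
Qed.

Definition shift s F : 'M[{poly K}]_2 := map_mx (comp_poly ('X + s%:~R)) F.

Definition mulSD x y : SD K :=
  lin_ext (fun r F => lin_ext (fun s G => mono (r + s) (shift s F *m G)) y) x.

Lemma shiftD s : {morph shift s : F G / F + G}.
Proof. by move=> F G; rewrite /shift map_mxD. Qed.

Lemma shift0 s : shift s 0 = 0. Proof. exact: map_mx0. Qed.

Lemma shift1 s : shift s 1 = 1. Proof. exact: map_mx1. Qed.

Lemma shiftM s F G : shift s (F *m G) = shift s F *m shift s G.
Proof. exact: map_mxM. Qed.

Lemma shift_id F : shift 0 F = F.
Proof. by apply/matrixP => i j; rewrite mxE addr0 comp_polyXr. Qed.

Lemma shift_add s r F : shift s (shift r F) = shift (r + s) F.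
Proof.
apply/matrixP => i j; rewrite !mxE -comp_polyA; congr (_ \Po _).
by rewrite comp_polyD comp_polyX rmorph_int intrD [r%:~R + _]addrC addrA.
Qed.

Lemma shiftZ s c F : shift s (c%:P *: F) = c%:P *: shift s F.
Proof. by apply/matrixP => i j; rewrite !mxE rmorphM /= comp_polyC. Qed.

Let term_r r F s : {morph (fun G => mono (r + s) (shift s F *m G)) : G H / G + H}.
Proof. by move=> G H; rewrite mulmxDr monoD. Qed.

Lemma mulSD_mono r s F G : mulSD (mono r F) (mono s G) = mono (r + s) (shift s F *m G).
Proof.
rewrite /mulSD lin_ext_mono; first by rewrite lin_ext_mono // mulmx0 mono0.
by rewrite lin_extE big1 // => i _; rewrite shift0 mul0mx mono0.
Qed.

Lemma mulSDDl : left_distributive mulSD +%R.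
Proof.
move=> x y z; rewrite /mulSD lin_extD // => r F G.
by rewrite !lin_extE -big_split /=; apply: eq_bigr => s _; rewrite shiftD mulmxDl monoD.
Qed.

Lemma mulSDDr : right_distributive mulSD +%R.
Proof.
move=> x y z; rewrite /mulSD !lin_extE -big_split /=; apply: eq_bigr => r _.
by apply: (lin_extD (h := fun s G => mono (r + s) (shift s (coef x r) *m G))) => s G H;
  apply: term_r.
Qed.

Lemma mulSD0l x : mulSD 0 x = 0.
Proof. by apply: (addIr (mulSD 0 x)); rewrite -mulSDDl !add0r. Qed.

Lemma mulSD0r x : mulSD x 0 = 0.
Proof. by apply: (addIr (mulSD x 0)); rewrite -mulSDDr !add0r. Qed.

Lemma mulSDA : associative mulSD.
Proof.
move=> x y z; elim/SD_ind: x => [|x x' hx hx'|r F]; rewrite ?mulSD0l ?mulSDDl ?hx ?hx' //.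
elim/SD_ind: y => [|y y' hy hy'|s G].
- by rewrite mulSD0l !mulSD0r mulSD0l.
- by rewrite mulSDDl !mulSDDr mulSDDl hy hy'.
elim/SD_ind: z => [|z z' hz hz'|u H]; rewrite ?mulSD0r ?mulSDDr ?hz ?hz' //.
by rewrite !mulSD_mono shiftM shift_add mulmxA addrA.
Qed.

Lemma mulSD1l : left_id (mono 0 1 : SD K) mulSD.
Proof.
elim/SD_ind => [|x x' hx hx'|r F]; rewrite ?mulSD0r ?mulSDDr ?hx ?hx' //.
by rewrite mulSD_mono add0r shift1 mul1mx.
Qed.

Lemma mulSD1r : right_id (mono 0 1 : SD K) mulSD.
Proof.
elim/SD_ind => [|x x' hx hx'|r F]; rewrite ?mulSD0l ?mulSDDl ?hx ?hx' //.
by rewrite mulSD_mono addr0 shift_id mulmx1.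
Qed.

Lemma oneSD_neq0 : mono 0 1 != 0 :> SD K.
Proof. by rewrite mono_def -(inj_eq val_inj) /= monalgU_eq0 oner_neq0. Qed.

HB.instance Definition _ := GRing.Zmodule_isNzRing.Build (SD K)
  mulSDA mulSD1l mulSD1r mulSDDl mulSDDr oneSD_neq0.

Lemma mono_mul r s F G : mono r F * mono s G = mono (r + s) (shift s F *m G).
Proof. exact: mulSD_mono. Qed.

Lemma scaleSDAl c x y : c *: (x * y) = c *: x * y.
Proof.
elim/SD_ind: x => [|x x' hx hx'|r F];
  rewrite ?mul0r ?scaler0 ?mul0r ?mulrDl ?scalerDr ?mulrDl ?hx ?hx' //.
elim/SD_ind: y => [|y y' hy hy'|s G]; rewrite ?mulr0 ?scaler0 ?mulrDr ?scalerDr ?hy ?hy' //.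
by rewrite -monoZ !mono_mul -monoZ shiftZ scalemxAl.
Qed.

Lemma scaleSDAr c x y : c *: (x * y) = x * (c *: y).
Proof.
elim/SD_ind: x => [|x x' hx hx'|r F];
  rewrite ?mul0r ?scaler0 ?mul0r ?mulrDl ?scalerDr ?mulrDl ?hx ?hx' //.
elim/SD_ind: y => [|y y' hy hy'|s G];
 rewrite ?scaler0 ?mulr0 ?scaler0 ?mulrDr ?scalerDr ?mulrDr ?hy ?hy' //.
by rewrite -monoZ !mono_mul -monoZ scalemxAr.
Qed.

HB.instance Definition _ := GRing.Lmodule_isLalgebra.Build K (SD K) scaleSDAl.
HB.instance Definition _ := GRing.Lalgebra_isAlgebra.Build K (SD K) scaleSDAr.
End SDAlgebra.

Inductive sgn := Plus | Minus.

Definition sgnv (K : fieldType) (e : sgn) : K := if e is Plus then 1 else -1.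

Section LieSD.
Variable K : fieldType.
Implicit Types (r s k : int) (p q : bool) (F G : 'M[{poly K}]_2) (x y z : SD K) (e : sgn).

(* The basis M_0, M_1, M_+, M_- multiplies as the matrix units below. *)
Definition M0 : 'M[{poly K}]_2 := delta_mx 0 0.
Definition M1 : 'M[{poly K}]_2 := delta_mx 1 1.
Definition Mp : 'M[{poly K}]_2 := delta_mx 0 1.
Definition Mm : 'M[{poly K}]_2 := delta_mx 1 0.

Definition tpow r : SD K := mono r 1.
Definition polD (f : {poly K}) : SD K := mono 0 f%:M.
Definition theta : SD K := mono 0 Mm.
Definition dtheta : SD K := mono 0 Mp.

(* Component of parity p, where true is odd. *)
Definition partmx p F : 'M[{poly K}]_2 := \matrix_(i, j) (if (i != j) == p then F i j else 0).
Definition part p : SD K -> SD K := lin_ext (fun r F => mono r (partmx p F)).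

Definition sbracket x y : SD K :=
  x * y - \sum_(p : bool) \sum_(q : bool) (-1) ^+ (p && q) *: (part q y * part p x).

(* The summation variable of the cocycle is j = - i, with 1 <= i <= n. *)
Definition psi_pos (n : nat) F G : K :=
  \sum_(1 <= i < n.+1)
    let j : K := - i%:R in
    ((F 0 0).[j] * (G 0 0).[j + n%:R] + (F 0 1).[j] * (G 1 0).[j + n%:R]
     - (F 1 0).[j] * (G 0 1).[j + n%:R] - (F 1 1).[j] * (G 1 1).[j + n%:R]).

Definition psi_mono r F G : K :=
  match r with
  | Posz n => psi_pos n F G
  | Negz n => - \sum_(p : bool) \sum_(q : bool)
                (-1) ^+ (p && q) * psi_pos n.+1 (partmx q G) (partmx p F)
  end.

Definition Psi x y : K := lin_ext (fun r F => psi_mono r F (coef y (- r))) x.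

(* sigma (t^r f(D)) = e1^r f(-D-1) t^r = e1^r t^r f(-D-r-1); moreover sigma
   exchanges M_0 and M_1, and multiplies M_+ by - e2 and M_- by e2. *)
Definition refl r (f : {poly K}) : {poly K} := f \Po (- 'X - (r + 1)%:~R).

Definition sigmx e1 e2 r F : 'M[{poly K}]_2 := (sgnv K e1 ^ r)%:P *:
    (refl r (F 1 1) *: M0 + refl r (F 0 0) *: M1
     - ((sgnv K e2)%:P * refl r (F 0 1)) *: Mp
     + ((sgnv K e2)%:P * refl r (F 1 0)) *: Mm).

Definition sigma e1 e2 : SD K -> SD K :=
  lin_ext (fun r F => mono r (sigmx e1 e2 r F)).

Lemma mx2P F G : F 0 0 = G 0 0 -> F 0 1 = G 0 1 -> F 1 0 = G 1 0 -> F 1 1 = G 1 1 -> F = G.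
Proof.
move=> h00 h01 h10 h11; apply/matrixP => i j.
have I2 (k : 'I_2) : k = 0 \/ k = 1.
  by case: k => [[|[|//]] ?]; [left|right]; apply/val_inj.
by case: (I2 i) => ->; case: (I2 j) => ->.
Qed.

Lemma tpowD r s : tpow (r + s) = tpow r * tpow s.
Proof. by rewrite mono_mul shift1 mulmx1. Qed.

Lemma shift_scalar r (f : {poly K}) : shift r f%:M = (f \Po ('X + r%:~R))%:M.
Proof. by rewrite /shift map_scalar_mx. Qed.

Lemma polDt f : polD f * tpow 1 = tpow 1 * polD (f \Po ('X + 1)).
Proof. by rewrite !mono_mul shift1 mulmx1 mul1mx shift_scalar addrC. Qed.

Lemma polDM f g : polD (f * g) = polD f * polD g.
Proof. by rewrite /polD mono_mul shift_id addr0 scalar_mxM. Qed.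

Lemma monoE r F : mono r F = tpow r *
  (polD (F 0 0) * (dtheta * theta) + polD (F 1 1) * (theta * dtheta)
   + polD (F 0 1) * dtheta + polD (F 1 0) * theta).
Proof.
rewrite /theta /dtheta !mono_mul !shift_id !add0r -!monoD mono_mul shift1 mul1mx addr0.
congr (mono _ _); rewrite !mul_delta_mx.
by apply: mx2P; rewrite !mul_scalar_mx !mxE /= ?(mulr1, mulr0, addr0, add0r).
Qed.

Lemma theta2 : theta * theta = 0.
Proof. by rewrite mono_mul shift_id mul_delta_mx_0 ?mono0. Qed.
Lemma dtheta2 : dtheta * dtheta = 0.
Proof. by rewrite mono_mul shift_id mul_delta_mx_0 ?mono0. Qed.
Lemma theta_dtheta : theta * dtheta + dtheta * theta = 1.
Proof.
rewrite !mono_mul !shift_id !mul_delta_mx -monoD; congr (mono _ _).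
by apply: mx2P; rewrite !mxE /= ?(addr0, add0r).
Qed.
Lemma shift_delta s (i j : 'I_2) : shift s (delta_mx i j : 'M[{poly K}]_2) = delta_mx i j.
Proof.
exact: map_delta_mx.
Qed.
Lemma theta_t r : theta * tpow r = tpow r * theta.
Proof. by rewrite !mono_mul shift1 shift_delta mulmx1 mul1mx addrC. Qed.
Lemma dtheta_t r : dtheta * tpow r = tpow r * dtheta.
Proof. by rewrite !mono_mul shift1 shift_delta mulmx1 mul1mx addrC. Qed.
Lemma theta_D f : theta * polD f = polD f * theta.
Proof. by rewrite !mono_mul !shift_id scalar_mxC. Qed.
Lemma dtheta_D f : dtheta * polD f = polD f * dtheta.
Proof. by rewrite !mono_mul !shift_id scalar_mxC. Qed.

Lemma sigmx00 e1 e2 r F : sigmx e1 e2 r F 0 0 = (sgnv K e1 ^ r)%:P * refl r (F 1 1).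
Proof. by rewrite !mxE /=; ring. Qed.
Lemma sigmx11 e1 e2 r F : sigmx e1 e2 r F 1 1 = (sgnv K e1 ^ r)%:P * refl r (F 0 0).
Proof. by rewrite !mxE /=; ring. Qed.
Lemma sigmx01 e1 e2 r F : sigmx e1 e2 r F 0 1 = - ((sgnv K e1 ^ r)%:P * (sgnv K e2)%:P * refl r (F 0 1)).
Proof. by rewrite !mxE /=; ring. Qed.
Lemma sigmx10 e1 e2 r F : sigmx e1 e2 r F 1 0 = (sgnv K e1 ^ r)%:P * (sgnv K e2)%:P * refl r (F 1 0).
Proof. by rewrite !mxE /=; ring. Qed.
Definition sigmxE := (sigmx00, sigmx01, sigmx10, sigmx11).

Lemma reflD r : {morph refl r : f g / f + g}.
Proof. by move=> f g; rewrite /refl rmorphD. Qed.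
Lemma reflM r : {morph refl r : f g / f * g}.
Proof. by move=> f g; rewrite /refl rmorphM. Qed.
Lemma refl0 r : refl r 0 = 0.
Proof. by rewrite /refl rmorph0. Qed.

Lemma sigmxD e1 e2 r : {morph sigmx e1 e2 r : F G / F + G}.
Proof.
move=> F G; apply: mx2P; rewrite [in RHS]mxE !sigmxE mxE reflD. all: ring.
Qed.
Lemma sigmaD e1 e2 : {morph sigma e1 e2 : x y / x + y}.
Proof. by move=> x y; apply: lin_extD => r F G; rewrite -monoD -sigmxD. Qed.
Lemma sigma_mono e1 e2 r F : sigma e1 e2 (mono r F) = mono r (sigmx e1 e2 r F).
Proof.
rewrite /sigma lin_ext_mono //.
suff -> : sigmx e1 e2 r 0 = 0 by rewrite mono0.
by apply: mx2P; rewrite !sigmxE !mxE refl0 ?mulr0 ?oppr0.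
Qed.
Lemma sigma0 e1 e2 : sigma e1 e2 0 = 0.
Proof. by apply: (addIr (sigma e1 e2 0)); rewrite -sigmaD !add0r. Qed.

Lemma partmxD p : {morph partmx p : F G / F + G}.
Proof. by move=> F G; apply/matrixP => i j; rewrite !mxE; case: ifP; rewrite ?addr0. Qed.
Lemma partmx0 p : partmx p 0 = 0.
Proof. by apply/matrixP => i j; rewrite !mxE; case: ifP. Qed.
Lemma partD p : {morph part p : x y / x + y}.
Proof. by move=> x y; apply: lin_extD => r F G; rewrite partmxD monoD. Qed.
Lemma part_mono p r F : part p (mono r F) = mono r (partmx p F).
Proof. by rewrite /part lin_ext_mono // partmx0 mono0. Qed.
Lemma part0 p : part p 0 = 0.
Proof. by apply: (addIr (part p 0)); rewrite -partD !add0r. Qed.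

Lemma sgnv_neq0 e : sgnv K e != 0.
Proof. by case: e; rewrite /= ?oppr_eq0 oner_neq0. Qed.
Lemma sgnv2 e : sgnv K e * sgnv K e = 1.
Proof. by case: e; rewrite /= ?mulrNN mulr1. Qed.

Lemma refl_shift r s f : refl (r + s) (f \Po ('X + s%:~R)) = refl r f.
Proof.
rewrite /refl -comp_polyA; congr (_ \Po _).
by rewrite comp_polyD comp_polyX rmorph_int !intrD; ring.
Qed.
Lemma shift_refl r s f : (refl s f) \Po ('X + r%:~R) = refl (r + s) f.
Proof.
rewrite /refl -comp_polyA; congr (_ \Po _).
by rewrite comp_polyB rmorphN /= comp_polyX rmorph_int !intrD; ring.
Qed.

Lemma mulmx2 F G (i j : 'I_2) : (F *m G) i j = F i 0 * G 0 j + F i 1 * G 1 j.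
Proof.
rewrite mxE !big_ord_recl big_ord0 addr0.
by have -> : lift ord0 ord0 = 1 :> 'I_2 by apply/val_inj.
Qed.

Definition shp s (f : {poly K}) := f \Po ('X + s%:~R).
Lemma shiftE s F i j : shift s F i j = shp s (F i j).
Proof. by rewrite /shift mxE. Qed.
Lemma shp0 s : shp s 0 = 0.
Proof. exact: rmorph0. Qed.
Lemma shpM s f g : shp s (f * g) = shp s f * shp s g.
Proof. exact: rmorphM. Qed.
Lemma shpN s f : shp s (- f) = - shp s f.
Proof. exact: rmorphN. Qed.
Lemma shpC s (c : K) : shp s c%:P = c%:P.
Proof. exact: comp_polyC. Qed.
Lemma shp_refl r s f : shp r (refl s f) = refl (r + s) f.
Proof. exact: shift_refl. Qed.
Definition shpE := (shpN, shpM, shpC, shp_refl).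
Lemma reflMM r s f g : refl (r + s) (shp s f * g) = refl r f * refl (r + s) g.
Proof. by rewrite reflM refl_shift. Qed.
Lemma partmxE p F i j : partmx p F i j = if (i != j) == p then F i j else 0.
Proof. by rewrite mxE. Qed.
Lemma scale_mono (c : K) r F : mono r (c%:P *: F) = c *: mono r F.
Proof. exact: monoZ. Qed.
Lemma scale_mxE (c : {poly K}) F i j : (c *: F) i j = c * F i j.
Proof. by rewrite mxE. Qed.

Lemma sigma_mul e1 e2 p q x y :
  sigma e1 e2 (part p x * part q y) =
  (-1) ^+ (p && q) *: (sigma e1 e2 (part q y) * sigma e1 e2 (part p x)).
Proof.
have e2E : (sgnv K e2)%:P * (sgnv K e2)%:P = 1 by rewrite -polyCM sgnv2.
elim/SD_ind: x => [|x x' hx hx'|r F].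
- by rewrite part0 mul0r sigma0 mulr0 scaler0.
- by rewrite partD mulrDl [LHS]sigmaD hx hx' [in RHS]sigmaD mulrDr scalerDr.
elim/SD_ind: y => [|y y' hy hy'|s G].
- by rewrite part0 mulr0 sigma0 mul0r scaler0.
- by rewrite partD mulrDr [LHS]sigmaD hy hy' [in RHS]sigmaD mulrDl scalerDr.
rewrite !part_mono !mono_mul !sigma_mono mono_mul -scale_mono [s + r]addrC; congr (mono _ _).
apply: mx2P; rewrite ?[RHS]scale_mxE ?sigmxE !mulmx2 !shiftE ?sigmxE !shpE !reflD !reflMM ?partmxE.
all: rewrite expfzDr ?sgnv_neq0 //= polyCM.
all: have := e2E; set c := (sgnv K e2)%:P; set a := (_ ^ r)%:P; set b := (_ ^ s)%:P.
all: move=> hc; case: p; case: q; rewrite /= ?refl0 ?shp0 ?expr0 ?expr1.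
all: rewrite ?(mulr0, mul0r, addr0, add0r, oppr0) //.
all: rewrite ?polyCN polyC1; try by ring.
all: by rewrite -[LHS]mul1r -[X in X * _ = _]hc; ring.
Qed.

Lemma sigmaZ e1 e2 (c : K) x : sigma e1 e2 (c *: x) = c *: sigma e1 e2 x.
Proof.
elim/SD_ind: x => [|x y hx hy|r F]; first by rewrite scaler0 sigma0 scaler0.
  by rewrite scalerDr !sigmaD hx hy scalerDr.
rewrite -monoZ !sigma_mono -monoZ; congr (mono _ _).
have rE r' f : refl r' (c%:P * f) = c%:P * refl r' f.
  by rewrite reflM; congr (_ * _); apply: comp_polyC.
by apply: mx2P; rewrite [RHS]scale_mxE !sigmxE !scale_mxE !rE; ring.
Qed.

Lemma sigma_tpow e1 e2 r : sigma e1 e2 (tpow r) = sgnv K e1 ^ r *: tpow r.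
Proof.
rewrite sigma_mono -monoZ; congr (mono _ _).
have r1 : refl r 1 = 1 :> {poly K} by exact: comp_polyC.
by apply: mx2P; rewrite [RHS]scale_mxE !sigmxE !mxE /= ?r1 ?refl0 ?mulr0 ?oppr0 ?mulr1.
Qed.

Lemma sigma_polD e1 e2 f : sigma e1 e2 (polD f) = polD (f \Po (- 'X - 1)).
Proof.
rewrite sigma_mono; congr (mono _ _).
have rf : refl 0 f = f \Po (- 'X - 1) by rewrite /refl add0r.
by apply: mx2P; rewrite !sigmxE !mxE /= expr0z ?mulr1n ?rf ?refl0 ?mulr0 ?oppr0 ?mul1r.
Qed.

Lemma sigma_theta e1 e2 : sigma e1 e2 theta = sgnv K e2 *: theta.
Proof.
rewrite sigma_mono -monoZ; congr (mono _ _).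
have r1 : refl 0 1 = 1 :> {poly K} by exact: comp_polyC.
by apply: mx2P; rewrite [RHS]scale_mxE !sigmxE !mxE /= expr0z ?r1 ?refl0 ?mulr0 ?oppr0 ?mulr1 ?mul1r.
Qed.

Lemma sigma_dtheta e1 e2 : sigma e1 e2 dtheta = - sgnv K e2 *: dtheta.
Proof.
rewrite sigma_mono -monoZ; congr (mono _ _).
have r1 : refl 0 1 = 1 :> {poly K} by exact: comp_polyC.
apply: mx2P; rewrite [RHS]scale_mxE !sigmxE !mxE /= expr0z ?r1 ?refl0 ?mulr0 ?oppr0 //.
by rewrite !mulr1 mul1r polyCN.
Qed.

Lemma part_sum x : x = \sum_(p : bool) part p x.
Proof.
rewrite big_bool /=.
elim/SD_ind: x => [|x y hx hy|r F]; first by rewrite !part0 addr0.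
  by rewrite !partD addrACA -hx -hy.
by rewrite !part_mono -monoD; congr (mono _ _); apply: mx2P;
  rewrite [RHS]mxE !partmxE /= ?addr0 ?add0r.
Qed.

Lemma sigma_part e1 e2 p x : sigma e1 e2 (part p x) = part p (sigma e1 e2 x).
Proof.
elim/SD_ind: x => [|x y hx hy|r F]; first by rewrite part0 sigma0 part0.
  by rewrite partD !sigmaD partD hx hy.
rewrite !part_mono !sigma_mono part_mono; congr (mono _ _).
apply: mx2P; rewrite partmxE !sigmxE partmxE; case: p => //=;
  by rewrite refl0 mulr0 ?oppr0.
Qed.

Lemma sigma_sum e1 e2 (I : finType) (f : I -> SD K) :
  sigma e1 e2 (\sum_i f i) = \sum_i sigma e1 e2 (f i).
Proof. exact: (big_morph _ (@sigmaD e1 e2) (sigma0 e1 e2)). Qed.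

Lemma sbracket_closed e1 e2 x y : sigma e1 e2 x = - x -> sigma e1 e2 y = - y ->
  sigma e1 e2 (sbracket x y) = - sbracket x y.
Proof.
move=> hx hy.
have partN p z : part p (- z) = - part p z.
  by apply: (addIr (part p z)); rewrite -partD !addNr part0.
have sx p : sigma e1 e2 (part p x) = - part p x by rewrite sigma_part hx partN.
have sy p : sigma e1 e2 (part p y) = - part p y by rewrite sigma_part hy partN.
have xyE : x * y = \sum_p \sum_q part p x * part q y.
  rewrite {1}[x]part_sum {1}[y]part_sum mulr_suml; apply: eq_bigr => p _.
  by rewrite mulr_sumr.
rewrite /sbracket; set S := \sum_p _; set T := x * y.
have sT : sigma e1 e2 T = S.
  rewrite /T xyE sigma_sum; apply: eq_bigr => p _.
  rewrite sigma_sum; apply: eq_bigr => q _.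
  by rewrite sigma_mul sx sy mulrNN.
have sS : sigma e1 e2 S = T.
  rewrite /T xyE sigma_sum; apply: eq_bigr => p _.
  rewrite sigma_sum; apply: eq_bigr => q _.
  rewrite sigmaZ sigma_mul sx sy mulrNN scalerA andbC -expr2 sqrr_sign scale1r.
  reflexivity.
have sN z : sigma e1 e2 (- z) = - sigma e1 e2 z.
  by apply: (addIr (sigma e1 e2 z)); rewrite -sigmaD !addNr sigma0.
by rewrite sigmaD sN sT sS opprB.
Qed.
End LieSD.

(* The central extension; the second component is the coefficient of C. *)
Definition SDhat (K : fieldType) : lmodType K := (SD K * K^o)%type.

Section CentralExtension.
Variable K : fieldType.
Implicit Types (x y : SDhat K).

Definition hemb (x : SD K) : SDhat K := (x, 0).
Definition central : SDhat K := (0, 1).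

Definition hbracket x y : SDhat K := (sbracket x.1 y.1, Psi x.1 y.1).

Definition hpart (p : bool) x : SDhat K := (part p x.1, if p then 0 else x.2).

(* Degrees are doubled throughout: hdeg k is the subspace of weight k / 2.
   The entry (i, j) of the coefficient of t^r has weight r + (i - j) / 2. *)
Definition hdeg (k : int) x : Prop :=
  (forall (r : int) (i j : 'I_2),
     coef x.1 r i j != 0 -> r * 2 + ((i : nat)%:Z - (j : nat)%:Z) = k) /\
  (x.2 != 0 -> k = 0).

End CentralExtension.

Section Modules.
Variables (K : fieldType) (e1 e2 : sgn).

Definition in_g (x : SDhat K) : Prop := sigma e1 e2 x.1 = - x.1.

Lemma hbracket_in_g x y : in_g x -> in_g y -> in_g (hbracket x y).
Proof. exact: sbracket_closed. Qed.

(* The elements spanning g_0 together with C. *)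
Definition g0elt (f : {poly K}) : SD K :=
  dtheta K * theta K * polD f - theta K * dtheta K * polD (f \Po (- 'X - 1)).

Let g0mx (f : {poly K}) : 'M[{poly K}]_2 := f *: M0 K - (f \Po (- 'X - 1)) *: M1 K.

Let g0eltE f : g0elt f = mono 0 (g0mx f).
Proof.
rewrite /g0elt !mono_mul !shift_id !addr0 !mul_delta_mx !mul_mx_scalar.
have monoN G : mono 0 (- G) = - mono 0 G :> SD K.
  by apply: (addIr (mono 0 G)); rewrite -monoD !addNr mono0.
by rewrite -monoN -monoD.
Qed.

Let refl0E f : refl 0 f = f \Po (- 'X - 1) :> {poly K}.
Proof. by rewrite /refl add0r. Qed.

Let reflK f : (f \Po (- 'X - 1)) \Po (- 'X - 1) = f :> {poly K}.
Proof.
rewrite -comp_polyA comp_polyB rmorphN /= comp_polyX comp_polyC.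
by rewrite opprD !opprK addrK comp_polyXr.
Qed.

Lemma g0P (x : SDhat K) :
  in_g x /\ hdeg 0 x <->
  exists f a, x = hemb (g0elt f) + a *: central K.
Proof.
have hE f a : hemb (g0elt f) + a *: central K = (g0elt f, a).
  by congr pair; rewrite /= ?scaler0 ?addr0 ?add0r // /GRing.scale /= mulr1.
have g00 f : g0mx f 0 0 = f by rewrite !mxE /=; ring.
have g01 f : g0mx f 0 1 = 0 by rewrite !mxE /=; ring.
have g10 f : g0mx f 1 0 = 0 by rewrite !mxE /=; ring.
have g11 f : g0mx f 1 1 = - (f \Po (- 'X - 1)) by rewrite !mxE /=; ring.
split=> [[]|[f [a ->]]]; last first.
  rewrite hE; split.
    rewrite /in_g /= g0eltE sigma_mono; apply: (addIr (mono 0 (g0mx f))).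
    rewrite addNr -monoD -[RHS](mono0 K 0); congr (mono _ _).
    apply: mx2P; rewrite mxE [RHS]mxE sigmxE ?g00 ?g01 ?g10 ?g11 refl0E expr0z.
    - by rewrite rmorphN /= reflK mul1r addNr.
    - by rewrite rmorph0 mulr0 oppr0 addr0.
    - by rewrite rmorph0 mulr0 addr0.
    - by rewrite mul1r subrr.
  split=> [r i j|]; last by [].
  rewrite /= g0eltE coef_mono; case: (0 =P r) => [<-|]; last by rewrite mulr0n mxE eqxx.
  rewrite mulr1n mul0r add0r.
  have I2 (k : 'I_2) : k = 0 \/ k = 1.
    by case: k => [[|[|//]] ?]; [left|right]; apply/val_inj.
  by case: (I2 i) => ->; case: (I2 j) => ->; rewrite ?g01 ?g10 ?eqxx.
case: x => x a; rewrite /in_g /= => sx [/= hx _].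
pose F := coef x 0.
have z r (i j : 'I_2) : r * 2 + ((i : nat)%:Z - (j : nat)%:Z) <> 0 -> coef x r i j = 0.
  by move=> h; apply/eqP; apply/negPn/negP => /hx.
have xE : x = mono 0 F.
  apply: SD_eq => r; rewrite coef_mono; case: (0 =P r) => [<-|nr]; first by rewrite mulr1n.
  by rewrite mulr0n; apply: mx2P; rewrite mxE; apply: z => /=; lia.
have F01 : F 0 1 = 0 by apply: z.
have F10 : F 1 0 = 0 by apply: z.
have F11 : F 1 1 = - (F 0 0 \Po (- 'X - 1)).
  have := congr1 (fun y => coef y 0 1 1 + F 1 1) sx.
  rewrite xE sigma_mono !coef_mono mulr1n sigmx11 expr0z mul1r refl0E => h.
  have cN : coef (- mono 0 F) 0 = - F.
    by apply: (addIr F); rewrite -{2}(mulr1n F) -(coef_mono 0 F 0) -coefD !addNr /coef mcoeff0.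
  by move: h; rewrite cN mxE addNr addrC => /eqP; rewrite addr_eq0 => /eqP.
exists (F 0 0), a; rewrite hE xE g0eltE; congr (mono _ _, _).
by apply: mx2P; rewrite ?g00 ?g01 ?g10 ?g11.
Qed.

(* Only the values of gact on g are meaningful. *)
Record gmodule := GModule {
  gm_car :> lmodType K;
  gact : SDhat K -> gm_car -> gm_car;
  gact_linr : forall x, in_g x ->
    forall a u v, gact x (a *: u + v) = a *: gact x u + gact x v;
  gact_linl : forall a x y v, in_g x -> in_g y ->
    gact (a *: x + y) v = a *: gact x v + gact y v;
  gact_bracket : forall x y v, in_g x -> in_g y ->
    gact (hbracket x y) v = gact x (gact y v)
      - \sum_(p : bool) \sum_(q : bool)
          (-1) ^+ (p && q) *: gact (hpart q y) (gact (hpart p x) v)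
}.

(* gr k is the subspace of degree k / 2. *)
Record graded_gmodule := GradedGModule {
  gg_mod :> gmodule;
  gr : int -> gg_mod -> Prop;
  gr_zero : forall k, gr k 0;
  gr_lin : forall k a u v, gr k u -> gr k v -> gr k (a *: u + v);
  gr_span : forall v, exists (s : seq int) (f : int -> gg_mod),
    (forall k, gr k (f k)) /\ v = \sum_(k <- s) f k;
  gr_free : forall (s : seq int) (f : int -> gg_mod),
    uniq s -> (forall k, gr k (f k)) -> \sum_(k <- s) f k = 0 ->
    forall k, k \in s -> f k = 0;
  gr_act : forall i j x v, in_g x -> hdeg i x -> gr j v -> gr (i + j) (gact x v)
}.

Definition gmorph (V W : gmodule) (f : V -> W) : Prop :=
  (forall a u v, f (a *: u + v) = a *: f u + f v) /\
  (forall x v, in_g x -> f (gact x v) = gact x (f v)).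

(* A linear form on g_0, given as a function on the whole of SDhat whose values
   outside g_0 are irrelevant. *)
Definition weight (xi : SDhat K -> K) : Prop :=
  forall a x y, in_g x -> hdeg 0 x -> in_g y -> hdeg 0 y ->
    xi (a *: x + y) = a * xi x + xi y.

Variable xi : SDhat K -> K.

Definition highest_vector (V : gmodule) (v : V) : Prop :=
  (forall x, in_g x -> hdeg 0 x -> gact x v = xi x *: v) /\
  (forall k x, 0 < k -> in_g x -> hdeg k x -> gact x v = 0).

(* (M, v) is the module induced from the one-dimensional module of weight xi,
   with v the image of the generator, characterised by the universal property
   of induction. *)
Definition induced_module (M : gmodule) (v : M) : Prop :=
  highest_vector v /\
  forall (W : gmodule) (w : W), highest_vector w ->
    exists f : M -> W, [/\ gmorph f, f v = w &
      forall f' : M -> W, gmorph f' -> f' v = w -> f' =1 f].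

Definition graded_submodule (V : graded_gmodule) (S : V -> Prop) : Prop :=
  [/\ S 0, forall a u v, S u -> S v -> S (a *: u + v),
      forall x v, in_g x -> S v -> S (gact x v) &
      forall v, S v -> exists (s : seq int) (f : int -> V),
        (forall k, gr k (f k) /\ S (f k)) /\ v = \sum_(k <- s) f k].

Definition irreducible_gmodule (V : graded_gmodule) : Prop :=
  (exists v : V, v <> 0) /\
  forall S : V -> Prop, graded_submodule S ->
    (forall v, S v -> v = 0) \/ (forall v, S v).

Definition irr_highest_weight (L : graded_gmodule) : Prop :=
  exists (M : graded_gmodule) (v : M) (pi : M -> L),
    [/\ induced_module v, gr 0 v, gmorph pi,
        (forall k u, gr k u -> gr k (pi u)) /\ (forall l, exists u, pi u = l) &
        irreducible_gmodule L].

End Modules.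

Definition quasifinite (K : fieldType) (e1 e2 : sgn) (V : graded_gmodule K e1 e2) : Prop :=
  forall k, exists b : seq V, forall v : V, gr k v ->
    exists c : nat -> K, v = \sum_(i < size b) c i *: b`_i.

(* Formal power series in x, as sequences of coefficients. *)
Section PowerSeries.
Variable K : fieldType.
Implicit Types (a b : nat -> K) (p : {poly K}).

Definition fps_mul a b : nat -> K := fun n => \sum_(i < n.+1) a i * b (n - i)%N.
Definition fps_const (c : K) : nat -> K := fun n => if n is 0 then c else 0.
Definition fps_exp (c : K) : nat -> K := fun n => c ^+ n / n`!%:R.
Definition fps_deriv a : nat -> K := fun n => n.+1%:R * a n.+1.
Definition fps_diffop p a : nat -> K :=
  fun n => \sum_(k < size p) p`_k * iter k fps_deriv a n.

(* Coefficients in K[w] of sinh(x (w + 1/2)) and cosh(x (w + 1/2)). *)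
Definition sinh_coef (n : nat) : {poly K} :=
  if odd n then n`!%:R^-1 *: ('X + (2%:R^-1)%:P) ^+ n else 0.
Definition cosh_coef (n : nat) : {poly K} :=
  if odd n then 0 else n`!%:R^-1 *: ('X + (2%:R^-1)%:P) ^+ n.

Definition Delta0 (xi : SDhat K -> K) : nat -> K :=
  fun n => - xi (hemb (polD (sinh_coef n))).
Definition Delta1 (xi : SDhat K -> K) : nat -> K :=
  fun n => - xi (hemb
    ((theta K * dtheta K - dtheta K * theta K) * polD (cosh_coef n))).

(* The arguments of xi above belong to g_0. *)
Lemma Delta_args_g0 (e1 e2 : sgn) n : 2%:R != 0 :> K ->
  [/\ in_g e1 e2 (hemb (polD (sinh_coef n))), hdeg 0 (hemb (polD (sinh_coef n))),
      in_g e1 e2 (hemb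
        ((theta K * dtheta K - dtheta K * theta K) * polD (cosh_coef n))) &
      hdeg 0 (hemb
        ((theta K * dtheta K - dtheta K * theta K) * polD (cosh_coef n)))].
Proof.
move=> n2; pose u : {poly K} := 'X + (2%:R^-1)%:P.
have polDN f : polD (- f) = - polD f :> SD K.
  apply: (addIr (polD f)); rewrite /polD -monoD addNr -[RHS](mono0 K 0).
  by congr (mono _ _); apply: mx2P; rewrite !mxE /= ?mulr1n ?mulr0n ?addNr ?addr0.
have uE : u \Po (- 'X - 1) = - u.
  have h : (2%:R^-1)%:P + (2%:R^-1)%:P = 1 :> {poly K}.
    by rewrite -polyCD -mulr2n -[_ *+ 2]mulr_natr mulVf.
  by rewrite /u comp_polyD comp_polyX comp_polyC -h; ring.
have uX m : (u ^+ m) \Po (- 'X - 1) = (-1) ^+ m * u ^+ m.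
  have -> : (u ^+ m) \Po (- 'X - 1) = (u \Po (- 'X - 1)) ^+ m by exact: rmorphXn.
  rewrite uE. by rewrite [LHS]exprNn.
have sE : polD (sinh_coef n) = g0elt (sinh_coef n).
  have H : sinh_coef n \Po (- 'X - 1) = - sinh_coef n.
    rewrite /sinh_coef; case: ifP => on; last by rewrite comp_poly0 oppr0.
    by rewrite comp_polyZ -/u uX -signr_odd on expr1 mulN1r scalerN.
  by rewrite /g0elt H polDN mulrN opprK -mulrDl addrC theta_dtheta mul1r.
have cE : (theta K * dtheta K - dtheta K * theta K) * polD (cosh_coef n)
    = g0elt (- cosh_coef n).
  have H : cosh_coef n \Po (- 'X - 1) = cosh_coef n.
    rewrite /cosh_coef; case: ifP => on; first by rewrite comp_poly0.
    by rewrite comp_polyZ -/u uX -signr_odd on expr0 mul1r.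
  by rewrite /g0elt rmorphN /= H polDN !mulrN opprK -mulNr -mulrDl addrC.
have g0 (f : {poly K}) : in_g e1 e2 (hemb (g0elt f)) /\ hdeg 0 (hemb (g0elt f)).
  by apply/g0P; exists f, 0; rewrite scale0r addr0.
by rewrite sE cE; case: (g0 (sinh_coef n)) => ? ?; case: (g0 (- cosh_coef n)).
Qed.

Definition even_poly p : Prop := p \Po - 'X = p.
Definition odd_poly p : Prop := p \Po - 'X = - p.

Definition parity_condition (e1 e2 : sgn) (alpha beta : {poly K}) : Prop :=
  match e1, e2 with
  | Plus, Plus => odd_poly alpha /\ even_poly beta
  | Plus, Minus => even_poly alpha /\ odd_poly beta
  | Minus, Plus => even_poly alpha /\ even_poly beta
  | Minus, Minus => odd_poly alpha /\ odd_poly beta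
  end.
End PowerSeries.

(* Main.v *)
Require Import Defs.
From mathcomp Require Import all_boot all_order all_algebra reals complex.
From mathcomp Require Import finmap monalg ring zify.

(** Write w for the polynomial variable, u = w + 1/2, g for the fixed
    subalgebra and v for the highest weight vector of L. Degrees are those of the
    principal gradation here, and twice that in the lemmas.

    The elements of g of degree -1/2 are sums of f(D) d/dtheta, where f has
    parity e2 as a polynomial in u, and of t^-1 f(D) theta, where f has parity
    - e1 e2 in w. As L is irreducible, a vector of degree -1/2 vanishes as soon
    as g_{1/2} kills it ([lower_zero]). Hence whether such an element kills v is
    a condition on the values of xi on its brackets with g_{1/2}, which lie in
    g_0. Let ell be the linear form that sends a polynomial f to the value of xi
    at f M_0 - f(-w-1) M_1. Then beta(u) d/dtheta kills v if and only if ell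
    vanishes at beta(u) q for all q of the parity opposite to beta in u, and
    t^-1 alpha(w) theta kills v if and only if ell vanishes at alpha(w) q for
    all q of the parity opposite to alpha in w. The central charge does not
    enter the second condition: the cocycle contributes the value at 0 of
    alpha q, which is odd.

    These conditions are the two differential equations. The series Delta_0 is
    minus ell(sinh(x u)), and by the addition formulas for sinh
    ([second_series]) the second series is -2 ell(sinh(x w)) - 2c. Applying
    beta(d/dx) or alpha(d/dx) to such a hyperbolic sine multiplies it by beta(u)
    or alpha(w) inside ell, and turns it into a hyperbolic cosine if the
    polynomial is odd ([diffop_odd_seriesP]). The constant 2c survives only
    if alpha(0) is nonzero, and then alpha may be replaced by w^2 alpha.

    If L is quasifinite, then in degree -1/2 both families of elements of g have
    an infinite-dimensional parameter space and a finite-dimensional image on v,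
    so each contains a nonzero element killing v ([kernel_of_quasifinite]), which
    gives alpha and beta.

    Conversely, suppose that alpha and beta exist. The elements of g that kill v
    are closed under brackets, and brackets with the two known families produce
    in every negative degree all elements whose polynomials are divisible by
    some fixed nonzero polynomial ([ideal_kills_all]); so g_j v is
    finite-dimensional for all j < 0. This property passes from v to x v, since
    y x v is [y, x] v plus or minus x y v, hence to every vector of L
    ([orbit_FD_all]). Since a vector of degree -N < 0 is a sum of vectors y v'
    with y of negative degree and v' of degree above -N, induction on N bounds
    all graded subspaces ([gr_FD]). *)

Set Implicit Arguments.
Unset Strict Implicit.
Unset Printing Implicit Defensive.

Import GRing.Theory Num.Theory.
Import Defs.
Local Open Scope ring_scope.

Lemma ord2P (i : 'I_2) : i = 0 \/ i = 1.
Proof. by case: i => [[|[|//]] ?]; [left|right]; apply/val_inj. Qed.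

(** * The gradation *)

Section Degrees.
Variable K : fieldType.
Implicit Types (r s k : int) (F G : 'M[{poly K}]_2) (x y : SD K).

Lemma coef_SD0 r : coef (0 : SD K) r = 0.
Proof. exact: mcoeff0. Qed.

Lemma monoN r F : mono r (- F) = - mono r F.
Proof. by apply: (addIr (mono r F)); rewrite -monoD !addNr mono0. Qed.

Lemma SD_sum x : x = \sum_(r <- msupp (SDval x)) mono r (coef x r).
Proof.
apply/val_inj; rewrite /= (big_morph _ (@SDvalD K) (SDval0 K)).
by rewrite [LHS]monalgE; apply: eq_bigr => r _; rewrite mono_def.
Qed.

Lemma mx2_sum F : F = F 0 0 *: M0 K + F 1 1 *: M1 K + F 0 1 *: Mp K + F 1 0 *: Mm K.
Proof. by apply: mx2P; rewrite !mxE /=; ring. Qed.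

(** The condition that [hdeg] puts on the component in [SD]. It is linear and
    does not mention the centre, so that it can be checked on monomials. *)
Definition sdeg k x : Prop := forall r (i j : 'I_2),
  coef x r i j != 0 -> r * 2 + ((i : nat)%:Z - (j : nat)%:Z) = k.

Lemma sdeg0 k : sdeg k 0.
Proof. by move=> r i j; rewrite coef_SD0 mxE eqxx. Qed.

Lemma sdegD k x y : sdeg k x -> sdeg k y -> sdeg k (x + y).
Proof.
move=> hx hy r i j; rewrite coefD mxE.
by have [->|/hx//] := eqVneq (coef x r i j) 0; rewrite add0r => /hy.
Qed.

Lemma sdegZ k c x : sdeg k x -> sdeg k (c *: x).
Proof.
by move=> hx r i j; rewrite coefZ mxE mulf_eq0 negb_or => /andP[_ /hx].
Qed.

Lemma sdegN k x : sdeg k x -> sdeg k (- x).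
Proof. by move=> hx; rewrite -scaleN1r; apply: sdegZ. Qed.

Lemma sdeg_sum k (I : eqType) (s : seq I) (P : pred I) (f : I -> SD K) :
  (forall i, P i -> sdeg k (f i)) -> sdeg k (\sum_(i <- s | P i) f i).
Proof. by move=> h; apply: big_ind => //; [apply: sdeg0|apply: sdegD]. Qed.

Lemma sdeg_mono k r F :
  (forall i j : 'I_2, F i j != 0 -> r * 2 + ((i : nat)%:Z - (j : nat)%:Z) = k) ->
  sdeg k (mono r F).
Proof.
move=> h s i j; rewrite coef_mono; case: (r =P s) => [<-|_]; first by rewrite mulr1n => /h.
by rewrite mulr0n mxE eqxx.
Qed.

Lemma sdeg_scale_delta r (f : {poly K}) (i j : 'I_2) :
  sdeg (r * 2 + ((i : nat)%:Z - (j : nat)%:Z)) (mono r (f *: delta_mx i j) : SD K).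
Proof.
apply: sdeg_mono => i' j'; rewrite !mxE.
by case: (i' =P i) => [->|] /=; case: (j' =P j) => [->|] //=; rewrite ?mulr0 ?eqxx.
Qed.

Lemma sdeg_mul k l x y : sdeg k x -> sdeg l y -> sdeg (k + l) (x * y).
Proof.
move=> hx hy; rewrite [x]SD_sum [y]SD_sum mulr_suml; apply: sdeg_sum => r _.
rewrite mulr_sumr; apply: sdeg_sum => s _; rewrite mono_mul; apply: sdeg_mono => i j.
rewrite mulmx2 !shiftE => nz.
have [m]: exists m : 'I_2, coef x r i m != 0 /\ coef y s m j != 0.
  have [x0|nx] := eqVneq (shp s (coef x r i 0) * coef y s 0 j) 0.
    exists 1; move: nz; rewrite x0 add0r mulf_eq0 negb_or => /andP[h ->]; split=> //.
    by apply: contraNneq h => ->; rewrite shp0.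
  exists 0; move: nx; rewrite mulf_eq0 negb_or => /andP[h ->]; split=> //.
  by apply: contraNneq h => ->; rewrite shp0.
by case=> /hx h1 /hy h2; lia.
Qed.

Lemma coef_part p x r : coef (part p x) r = partmx p (coef x r).
Proof.
move: x; apply: SD_ind => [|x y hx hy|s F]; first by rewrite part0 !coef_SD0 partmx0.
  by rewrite partD !coefD partmxD hx hy.
by rewrite part_mono !coef_mono; case: eqP; rewrite ?mulr1n ?mulr0n ?partmx0.
Qed.

Lemma sdeg_part k p x : sdeg k x -> sdeg k (part p x).
Proof.
move=> hx r i j; rewrite coef_part partmxE.
by case: ifP => [_ /hx //|_]; rewrite eqxx.
Qed.

Lemma sdeg_bracket k l x y : sdeg k x -> sdeg l y -> sdeg (k + l) (sbracket x y).
Proof.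
move=> hx hy; apply: sdegD; first exact: sdeg_mul.
apply: sdegN; do 2![apply: sdeg_sum => ? _]; apply: sdegZ.
by rewrite addrC; apply: sdeg_mul; apply: sdeg_part.
Qed.

Lemma coef_sigma e1 e2 x r : coef (sigma e1 e2 x) r = sigmx e1 e2 r (coef x r).
Proof.
have s0 s : sigmx e1 e2 s 0 = 0 :> 'M[{poly K}]_2.
  by apply: mx2P; rewrite !sigmxE !mxE refl0 ?mulr0 ?oppr0.
move: x; apply: SD_ind => [|x y hx hy|s F]; first by rewrite sigma0 !coef_SD0 s0.
  by rewrite sigmaD !coefD sigmxD hx hy.
by rewrite sigma_mono !coef_mono; case: eqP => [->|]; rewrite ?mulr1n ?mulr0n ?s0.
Qed.

Lemma sdeg_sigma e1 e2 k x : sdeg k x -> sdeg k (sigma e1 e2 x).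
Proof.
move=> hx r i j; rewrite coef_sigma.
have nz (f g : {poly K}) : g * refl r f != 0 -> f != 0.
  by apply: contraNneq => ->; rewrite refl0 mulr0.
by case: (ord2P i) => ->; case: (ord2P j) => ->; rewrite !sigmxE ?oppr_eq0 => /nz /hx /=; lia.
Qed.

Lemma psi_pos_neq0 n F G : psi_pos n F G != 0 ->
  exists i j : 'I_2, F i j != 0 /\ G j i != 0.
Proof.
move=> nz; have [//|h] := boolP [exists i : 'I_2, [exists j : 'I_2, (F i j != 0) && (G j i != 0)]].
  by case/existsP => i /existsP[j /andP[? ?]]; exists i, j.
case/eqP: nz; apply: big1 => m _.
have z i j (a b : K) : (F i j).[a] * (G j i).[b] = 0.
  apply/eqP; rewrite mulf_eq0; apply: contraR h; rewrite negb_or => /andP[ha hb].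
  apply/existsP; exists i; apply/existsP; exists j; apply/andP; split.
    by apply: contraNneq ha => ->; rewrite horner0.
  by apply: contraNneq hb => ->; rewrite horner0.
by rewrite /= !z !subr0 addr0.
Qed.

Lemma psi_mono_neq0 r F G : psi_mono r F G != 0 ->
  exists i j : 'I_2, F i j != 0 /\ G j i != 0.
Proof.
case: r => n /=; first exact: psi_pos_neq0.
rewrite oppr_eq0 => nz.
have [p [q]] : exists p q : bool, psi_pos n.+1 (partmx q G) (partmx p F) != 0.
  have [/existsP[p /existsP[q h]]|h] :=
    boolP [exists p : bool, [exists q : bool, psi_pos n.+1 (partmx q G) (partmx p F) != 0]].
    by exists p, q.
  case/eqP: nz; apply: big1 => p _; apply: big1 => q _.
  by apply/eqP; rewrite mulf_eq0; apply/orP; right; apply: contraR h => ?;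
    apply/existsP; exists p; apply/existsP; exists q.
case/psi_pos_neq0 => i [j]; rewrite !partmxE => -[h1 h2]; exists j, i.
by split; [move: h2|move: h1]; case: ifP; rewrite ?eqxx.
Qed.

(** Each summand of the cocycle multiplies an entry (i, j) of a coefficient of
    t^r by an entry (j, i) of a coefficient of t^-r, and these have opposite
    degrees. This is what makes the central extension graded. *)
Lemma Psi_sdeg k l x y : sdeg k x -> sdeg l y -> Psi x y != 0 -> k + l = 0.
Proof.
move=> hx hy; have [//|kl] := eqVneq (k + l) 0; rewrite /Psi lin_extE big1 ?eqxx // => r _.
apply/eqP; apply: contraNT kl => /psi_mono_neq0[i [j [/hx <- /hy <-]]].
by apply/eqP; lia.
Qed.
End Degrees.

(** * The fixed subalgebra and its generators *)

Section Fixed.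
Variables (K : numFieldType) (e1 e2 : sgn).
Implicit Types (r s k : int) (F G : 'M[{poly K}]_2) (x y : SD K) (X Y : SDhat K).
Local Notation sg := (sigma e1 e2).

Lemma hdeg_hemb k x : hdeg k (hemb x) <-> sdeg k x.
Proof. by split=> [[]//|h]; split=> //=; rewrite eqxx. Qed.

Lemma hdeg_bracket k l X Y : hdeg k X -> hdeg l Y -> hdeg (k + l) (hbracket X Y).
Proof.
by move=> [hX _] [hY _]; split; [apply: sdeg_bracket | apply: Psi_sdeg].
Qed.

Lemma hdeg_part k p X : hdeg k X -> hdeg k (hpart p X).
Proof.
move=> [hX cX]; split; first exact: sdeg_part.
by case: p; rewrite //= eqxx.
Qed.

Lemma sigmaN x : sg (- x) = - sg x.
Proof. by rewrite -scaleN1r sigmaZ scaleN1r. Qed.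

Lemma partN p x : part p (- x) = - part p x.
Proof. by apply: (addIr (part p x)); rewrite -partD !addNr part0. Qed.

Lemma in_g0 : in_g e1 e2 (0 : SDhat K).
Proof. by rewrite /in_g /= sigma0 oppr0. Qed.

Lemma in_gZ a X : in_g e1 e2 X -> in_g e1 e2 (a *: X).
Proof. by rewrite /in_g /= sigmaZ => ->; rewrite scalerN. Qed.

Lemma in_g_part p X : in_g e1 e2 X -> in_g e1 e2 (hpart p X).
Proof. by rewrite /in_g /= sigma_part => ->; rewrite partN. Qed.

Lemma in_g_central : in_g e1 e2 (central K).
Proof. by rewrite /in_g /= sigma0 oppr0. Qed.

Lemma reflK r (f : {poly K}) : refl r (refl r f) = f.
Proof.
rewrite /refl -comp_polyA comp_polyB rmorphN /= comp_polyX rmorph_int.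
by rewrite opprD !opprK addrK comp_polyXr.
Qed.

Lemma reflC r (c : K) : refl r c%:P = c%:P.
Proof. exact: comp_polyC. Qed.

Lemma reflN r (f : {poly K}) : refl r (- f) = - refl r f.
Proof. exact: rmorphN. Qed.

Lemma sgnvX2 e r : (sgnv K e ^ r) * (sgnv K e ^ r) = 1.
Proof. by rewrite -expfzMl sgnv2 exp1rz. Qed.

Lemma sigmaK x : sg (sg x) = x.
Proof.
elim/SD_ind: x => [|x y hx hy|r F]; first by rewrite !sigma0.
  by rewrite !sigmaD hx hy.
rewrite !sigma_mono; congr (mono _ _).
have E1 : (sgnv K e1 ^ r)%:P * (sgnv K e1 ^ r)%:P = 1 by rewrite -polyCM sgnvX2.
have E2 : (sgnv K e2)%:P * (sgnv K e2)%:P = 1 by rewrite -polyCM sgnv2.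
have invol (a b f : {poly K}) : a * a = 1 -> b * b = 1 -> a * b * (a * b * f) = f.
  by move=> ha hb; rewrite mulrA mulrACA ha hb !mul1r.
apply: mx2P; rewrite !sigmxE ?reflN !reflM !reflC reflK.
- by rewrite mulrA E1 mul1r.
- by rewrite mulrN opprK; apply: invol.
- exact: invol.
- by rewrite mulrA E1 mul1r.
Qed.

(** As [sigma] is an involution, x - sigma x runs over the whole fixed subalgebra
    while x is subject to no symmetry condition. *)
Definition skew x : SD K := x - sg x.

Lemma skew0 : skew 0 = 0.
Proof. by rewrite /skew sigma0 subr0. Qed.

Lemma skewD x y : skew (x + y) = skew x + skew y.
Proof. by rewrite /skew sigmaD opprD addrACA. Qed.

Lemma skewZ a x : skew (a *: x) = a *: skew x.
Proof. by rewrite /skew sigmaZ scalerBr. Qed.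

Lemma skew_sigma x : skew (sg x) = - skew x.
Proof. by rewrite /skew sigmaK opprB. Qed.

Lemma part_skew p x : part p (skew x) = skew (part p x).
Proof. by rewrite /skew partD partN sigma_part. Qed.

Lemma in_g_skew x : in_g e1 e2 (hemb (skew x)).
Proof. by rewrite /in_g /= /skew sigmaD sigmaN sigmaK opprB addrC. Qed.

Lemma skew_half X : in_g e1 e2 X -> X.1 = skew (2%:R^-1 *: X.1).
Proof.
move=> hX; rewrite skewZ /skew hX opprK -mulr2n -scaler_nat scalerA mulVf ?scale1r //.
by rewrite pnatr_eq0.
Qed.

Lemma sdeg_skew k x : sdeg k x -> sdeg k (skew x).
Proof. by move=> h; apply: sdegD => //; apply/sdegN/sdeg_sigma. Qed.

Lemma hembD x y : hemb (x + y) = hemb x + hemb y.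
Proof. by congr pair; rewrite /= addr0. Qed.

Lemma hembZ a x : hemb (a *: x) = a *: hemb x.
Proof. by congr pair; rewrite /= scaler0. Qed.

Lemma SDhat_split X : X = hemb X.1 + X.2 *: central K.
Proof.
by case: X => x a; congr pair; rewrite /= ?scaler0 ?addr0 ?add0r // /GRing.scale /= mulr1.
Qed.

(** Closure of a submodule under the Lie superalgebra only has to be checked on
    homogeneous elements, because the subalgebra is spanned by C and the skew
    parts of monomials with a single nonzero entry. *)
Lemma homog_ind (P : SDhat K -> Prop) :
  P 0 -> (forall X Y, in_g e1 e2 X -> in_g e1 e2 Y -> P X -> P Y -> P (X + Y)) ->
  (forall k X, in_g e1 e2 X -> hdeg k X -> P X) ->
  forall X, in_g e1 e2 X -> P X.
Proof.
move=> P0 PD Ph X hX; rewrite (SDhat_split X).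
apply: (PD) => //; first by apply/in_gZ/in_g_central.
  rewrite (skew_half hX); move: (_ *: _).
  apply: SD_ind => [|x y hx hy|r F]; first by rewrite skew0.
    by rewrite skewD hembD; apply: (PD) => //; apply: in_g_skew.
  have Pd i j : P (hemb (skew (mono r (F i j *: delta_mx i j)))).
    apply: (Ph (r * 2 + ((i : nat)%:Z - (j : nat)%:Z))); first exact: in_g_skew.
    exact/hdeg_hemb/sdeg_skew/sdeg_scale_delta.
  have Pa x y : P (hemb (skew x)) -> P (hemb (skew y)) -> P (hemb (skew (x + y))).
    by rewrite skewD hembD => ? ?; apply: (PD) => //; apply: in_g_skew.
  by rewrite (mx2_sum F) !monoD; apply: (Pa); [apply: (Pa); [apply: (Pa)|]|]; apply: Pd.
apply: (Ph 0); first by apply/in_gZ/in_g_central.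
by split=> [r i j|//]; rewrite /= scaler0 coef_SD0 mxE eqxx.
Qed.

Lemma sigma_bracket x y : sg (sbracket x y) = - sbracket (sg x) (sg y).
Proof.
have s (p q : bool) a b : sg (part p a * part q b) =
    (-1) ^+ (p && q) *: (part q (sg b) * part p (sg a)).
  by rewrite sigma_mul !sigma_part.
have xyE a b : a * b = \sum_p \sum_q part p a * part q b :> SD K.
  rewrite {1}[a]part_sum {1}[b]part_sum mulr_suml; apply: eq_bigr => p _.
  by rewrite mulr_sumr.
rewrite /sbracket sigmaD sigmaN opprB; congr (_ + _).
  rewrite xyE sigma_sum; apply: eq_bigr => p _; rewrite sigma_sum; apply: eq_bigr => q _.
  exact: s.
congr (- _); rewrite [RHS]xyE !sigma_sum; apply: eq_bigr => p _.
rewrite sigma_sum; apply: eq_bigr => q _.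
by rewrite sigmaZ s andbC scalerA -expr2 sqrr_sign scale1r.
Qed.

Lemma sbracketDl x x' y : sbracket (x + x') y = sbracket x y + sbracket x' y.
Proof.
rewrite /sbracket mulrDl [RHS]addrACA -opprD; congr (_ - _).
rewrite -big_split; apply: eq_bigr => p _ /=; rewrite -big_split; apply: eq_bigr => q _ /=.
by rewrite partD mulrDr scalerDr.
Qed.

Lemma sbracketNl x y : sbracket (- x) y = - sbracket x y.
Proof.
apply: (addIr (sbracket x y)); rewrite -sbracketDl !addNr /sbracket mul0r big1 ?subr0 // => p _.
by rewrite big1 // => q _; rewrite part0 mulr0 scaler0.
Qed.

(** [sigma] reverses the brackets up to sign, so only the first of the two terms
    of [skew x] has to be bracketed with y. *)
Lemma skew_bracket x y : sg y = - y -> sbracket (skew x) y = skew (sbracket x y).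
Proof.
have bNr (a b : SD K) : sbracket a (- b) = - sbracket a b.
  rewrite /sbracket mulrN opprB addrC; congr (_ - _).
  rewrite -sumrN; apply: eq_bigr => p _; rewrite -sumrN; apply: eq_bigr => q _.
  by rewrite partN mulNr scalerN opprK.
move=> hy; rewrite /skew sbracketDl sbracketNl sigma_bracket hy.
by rewrite bNr opprK.
Qed.

(** The skew parts of t^r f(D) M_0, t^r f(D) M_+ and t^r f(D) M_-. They span the
    subalgebra (see [hdeg_even] and [hdeg_odd]), linearly in an arbitrary
    polynomial f; [gup] and [glo] stand for entries above and below the
    diagonal. *)
Definition gdiag r (f : {poly K}) := skew (mono r (f *: M0 K)).
Definition gup r (f : {poly K}) := skew (mono r (f *: Mp K)).
Definition glo r (f : {poly K}) := skew (mono r (f *: Mm K)).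

Local Notation s1 r := ((sgnv K e1 ^ r)).
Local Notation s2 := (sgnv K e2).

(** The entries that the skew part puts above and below the diagonal: f made
    symmetric or antisymmetric under [refl r], up to the sign e1^r e2. *)
Definition upent r f := f + (s1 r * s2)%:P * refl r f.
Definition loent r f := f - (s1 r * s2)%:P * refl r f.

Lemma gupE r f : gup r f = mono r (upent r f *: Mp K).
Proof.
rewrite /gup /skew /upent sigma_mono -monoN -monoD; congr (mono _ _).
by apply: mx2P; rewrite !mxE /= ?(mulr0, mulr1) ?refl0 ?polyCM; ring.
Qed.

Lemma gloE r f : glo r f = mono r (loent r f *: Mm K).
Proof.
rewrite /glo /skew /loent sigma_mono -monoN -monoD; congr (mono _ _).
by apply: mx2P; rewrite !mxE /= ?(mulr0, mulr1) ?refl0 ?polyCM; ring.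
Qed.

Lemma gdiagE r f : gdiag r f = mono r (f *: M0 K - ((s1 r)%:P * refl r f) *: M1 K).
Proof.
rewrite /gdiag /skew sigma_mono -monoN -monoD; congr (mono _ _).
by apply: mx2P; rewrite !mxE /= ?(mulr0, mulr1) ?refl0; ring.
Qed.

Lemma gdiagD r f g : gdiag r (f + g) = gdiag r f + gdiag r g.
Proof. by rewrite /gdiag scalerDl monoD skewD. Qed.
Lemma gupD r f g : gup r (f + g) = gup r f + gup r g.
Proof. by rewrite /gup scalerDl monoD skewD. Qed.
Lemma gloD r f g : glo r (f + g) = glo r f + glo r g.
Proof. by rewrite /glo scalerDl monoD skewD. Qed.
Lemma gdiagZ r c f : gdiag r (c *: f) = c *: gdiag r f.
Proof. by rewrite /gdiag -skewZ -monoZ scalerA mul_polyC. Qed.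
Lemma gupZ r c f : gup r (c *: f) = c *: gup r f.
Proof. by rewrite /gup -skewZ -monoZ scalerA mul_polyC. Qed.
Lemma gloZ r c f : glo r (c *: f) = c *: glo r f.
Proof. by rewrite /glo -skewZ -monoZ scalerA mul_polyC. Qed.

Lemma hdeg_gdiag r f : hdeg (r * 2) (hemb (gdiag r f)).
Proof. by apply/hdeg_hemb/sdeg_skew; have := @sdeg_scale_delta K r f 0 0; rewrite subrr addr0. Qed.
Lemma hdeg_gup r f : hdeg (r * 2 - 1) (hemb (gup r f)).
Proof. by apply/hdeg_hemb/sdeg_skew; have := @sdeg_scale_delta K r f 0 1. Qed.
Lemma hdeg_glo r f : hdeg (r * 2 + 1) (hemb (glo r f)).
Proof. by apply/hdeg_hemb/sdeg_skew; have := @sdeg_scale_delta K r f 1 0. Qed.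

Lemma hdeg_even r X : r != 0 -> in_g e1 e2 X -> hdeg (r * 2) X -> exists f, X = hemb (gdiag r f).
Proof.
move=> r0 gX [dX cX]; pose F := coef X.1 r.
have X2 : X.2 = 0 by apply/eqP/negPn/negP => /cX; move: r0 => /eqP; lia.
have z s (i j : 'I_2) : s * 2 + ((i : nat)%:Z - (j : nat)%:Z) <> r * 2 -> coef X.1 s i j = 0.
  by move=> h; apply/eqP; apply/negPn/negP => /dX.
have xE : X.1 = mono r F.
  apply: SD_eq => s; rewrite coef_mono; case: (r =P s) => [<-|nr]; first by rewrite mulr1n.
  by rewrite mulr0n; apply: mx2P; rewrite mxE; apply: z => /=; lia.
exists (2%:R^-1 *: F 0 0 - 2%:R^-1 *: ((s1 r)%:P * refl r (F 1 1))).
rewrite [X]SDhat_split X2 scale0r addr0; congr hemb.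
rewrite (skew_half gX) xE {1}(mx2_sum F).
have -> : F 0 1 = 0 by apply: z => /=; lia.
have -> : F 1 0 = 0 by apply: z => /=; lia.
rewrite !scale0r !addr0 skewZ monoD skewD gdiagD gdiagZ -scaleNr gdiagZ scaleNr -scalerBr.
congr (_ *: (_ + _)).
rewrite -[LHS]opprK -skew_sigma sigma_mono; congr (- skew (mono _ _)).
by apply: mx2P; rewrite !sigmxE !mxE /= ?(mulr0, mulr1) ?refl0 ?mulr0 ?oppr0.
Qed.

Lemma hdeg_odd r X : in_g e1 e2 X -> hdeg (r * 2 - 1) X ->
  exists f g, X = hemb (gup r f) + hemb (glo (r - 1) g).
Proof.
move=> gX [dX cX]; pose F := coef X.1 r; pose G := coef X.1 (r - 1).
have X2 : X.2 = 0 by apply/eqP/negPn/negP => /cX; lia.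
have z s (i j : 'I_2) : s * 2 + ((i : nat)%:Z - (j : nat)%:Z) <> r * 2 - 1 -> coef X.1 s i j = 0.
  by move=> h; apply/eqP; apply/negPn/negP => /dX.
have xE : X.1 = mono r (F 0 1 *: Mp K) + mono (r - 1) (G 1 0 *: Mm K).
  apply: SD_eq => s; rewrite Defs.coefD !coef_mono.
  case: (r =P s) => [<-|nr].
    have -> : (r - 1 == r) = false by apply/eqP; lia.
    rewrite mulr1n mulr0n addr0; apply: mx2P; rewrite !mxE /= ?mulr0 ?mulr1 //; apply: z => /=; lia.
  rewrite mulr0n add0r; case: (r - 1 =P s) => [<-|nr'].
    rewrite mulr1n; apply: mx2P; rewrite !mxE /= ?mulr0 ?mulr1 //; apply: z => /=; lia.
  by rewrite mulr0n; apply: mx2P; rewrite mxE; apply: z => /=; lia.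
exists (2%:R^-1 *: F 0 1), (2%:R^-1 *: G 1 0).
rewrite [X]SDhat_split X2 scale0r addr0 -hembD; congr hemb.
by rewrite (skew_half gX) xE skewZ skewD gupZ gloZ -scalerDr.
Qed.

Lemma part_delta p r f (i j : 'I_2) :
  part p (mono r (f *: delta_mx i j)) =
    if (i != j) == p then mono r (f *: delta_mx i j) else 0 :> SD K.
Proof.
rewrite part_mono; case: ifP => h; last rewrite -[RHS](mono0 K r).
all: congr (mono _ _); apply/matrixP => a b; rewrite !mxE.
all: case: (a =P i) => [->|] /=; last by case: ifP; rewrite ?mulr0.
all: by case: (b =P j) => [->|] /=; rewrite ?h ?mulr0 //; case: ifP.
Qed.

Lemma sbracket_delta r s f g (i j i' j' : 'I_2) :
  sbracket (mono r (f *: delta_mx i j)) (mono s (g *: delta_mx i' j')) =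
  mono (r + s) ((shp s f * g) *: (delta_mx i j *m delta_mx i' j')
    - ((-1) ^+ ((i != j) && (i' != j')) * (shp r g * f)) *:
        (delta_mx i' j' *m delta_mx i j)) :> SD K.
Proof.
rewrite /sbracket !big_bool /= !part_delta.
have sh a b (h : {poly K}) : shift r (h *: delta_mx a b) = shp r h *: delta_mx a b.
  by rewrite /shift map_mxZ /= map_delta_mx.
have sh' a b (h : {poly K}) : shift s (h *: delta_mx a b) = shp s h *: delta_mx a b.
  by rewrite /shift map_mxZ /= map_delta_mx.
set A := mono r _; set B := mono s _.
have AB : A * B = mono (r + s) ((shp s f * g) *: (delta_mx i j *m delta_mx i' j')).
  by rewrite mono_mul sh' -scalemxAl -scalemxAr scalerA.
have BA : B * A = mono (r + s) ((shp r g * f) *: (delta_mx i' j' *m delta_mx i j)).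
  by rewrite mono_mul sh -scalemxAl -scalemxAr scalerA addrC.
rewrite monoD AB; congr (_ + _); rewrite monoN; congr (- _).
have sE (b : bool) : mono (r + s) (((-1) ^+ b * (shp r g * f)) *: (delta_mx i' j' *m delta_mx i j))
   = (-1) ^+ b *: (B * A) :> SD K.
  by rewrite BA -monoZ scalerA polyC_exp polyCN.
rewrite sE.
case: (i != j); case: (i' != j') => /=; rewrite ?(mulr0, mul0r, scaler0, addr0, add0r) //;
 by rewrite ?expr0 ?scale1r.
Qed.

Lemma Psi_mono r s F G : Psi (mono r F) (mono s G) = if r + s == 0 then psi_mono r F G else 0.
Proof.
have pp0l n H : psi_pos n 0 H = 0 :> K.
  by rewrite /psi_pos big1 // => i _; rewrite /= !mxE !horner0 !mul0r !subr0 addr0.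
have pp0r n H : psi_pos n H 0 = 0 :> K.
  by rewrite /psi_pos big1 // => i _; rewrite /= !mxE !horner0 !mulr0 !subr0 addr0.
have p0l a H : psi_mono a 0 H = 0 :> K.
  case: a => n //=; rewrite big1 ?oppr0 // => p _; rewrite big1 // => q _.
  by rewrite partmx0 pp0r mulr0.
have p0r a H : psi_mono a H 0 = 0 :> K.
  case: a => n //=; rewrite big1 ?oppr0 // => p _; rewrite big1 // => q _.
  by rewrite partmx0 pp0l mulr0.
rewrite /Psi lin_ext_mono // coef_mono; have -> : (s == - r) = (r + s == 0).
  by rewrite addrC addr_eq0.
by case: ifP => _; rewrite ?mulr1n ?mulr0n.
Qed.

Lemma psi_pos0 F G : psi_pos 0 F G = 0.
Proof. by rewrite /psi_pos big_geq. Qed.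

Lemma hbracket_mono r s F G : r + s != 0 ->
  hbracket (hemb (mono r F)) (hemb (mono s G)) = hemb (sbracket (mono r F) (mono s G)).
Proof. by move=> h; rewrite /hbracket /= Psi_mono (negPf h). Qed.
End Fixed.

(** * Finite-dimensional spans *)

Section Span.
Variables (K : fieldType) (V : lmodType K).
Implicit Types (b : seq V) (u v : V).

(** The recursive form suits inductions over the spanning sequence; [in_spanP]
    relates it to linear combinations. *)
Fixpoint in_span b v : Prop :=
  if b is x :: b' then exists a v', v = a *: x + v' /\ in_span b' v' else v = 0.

Lemma in_spanP b v :
  in_span b v <-> exists c : nat -> K, v = \sum_(i < size b) c i *: b`_i.
Proof.
elim: b v => [|x b IH] v /=.
  by split=> [->|[c ->]]; [exists (fun=> 0)|]; rewrite big_ord0.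
split=> [[a [v' [-> /IH[c ->]]]]|[c ->]].
  by exists (fun n => if n is m.+1 then c m else a); rewrite big_ord_recl.
rewrite big_ord_recl /=; exists (c 0), (\sum_(i < size b) c i.+1 *: b`_i); split=> //.
by apply/IH; exists (fun n => c n.+1).
Qed.

Lemma in_span0 b : in_span b 0.
Proof. by elim: b => //= x b IH; exists 0, 0; rewrite scale0r addr0. Qed.

Lemma in_span_lin b a u v : in_span b u -> in_span b v -> in_span b (a *: u + v).
Proof.
elim: b u v => [|x b IH] u v /=; first by move=> -> ->; rewrite scaler0 addr0.
case=> c [u' [-> hu]] [d [v' [-> hv]]]; exists (a * c + d), (a *: u' + v').
by split; [rewrite scalerDr scalerDl scalerA addrACA|apply: IH].
Qed.

Lemma in_spanZ b a u : in_span b u -> in_span b (a *: u).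
Proof. by move=> h; rewrite -[_ *: _]addr0; apply: in_span_lin => //; apply: in_span0. Qed.

Lemma in_spanD b u v : in_span b u -> in_span b v -> in_span b (u + v).
Proof. by move=> h; rewrite -[u in u + v]scale1r; apply: in_span_lin. Qed.

Lemma in_span_catl b b' v : in_span b v -> in_span (b ++ b') v.
Proof.
elim: b v => [|x b IH] v /=; first by move->; apply: in_span0.
by case=> a [v' [-> /IH h]]; exists a, v'.
Qed.

Lemma in_span_catr b b' v : in_span b' v -> in_span (b ++ b') v.
Proof.
by elim: b v => [|x b IH] v //= h; exists 0, v; rewrite scale0r add0r; split=> //; apply: IH.
Qed.

Lemma in_span_map (f : V -> V) b v :
  (forall a u v, f (a *: u + v) = a *: f u + f v) -> in_span b v -> in_span (map f b) (f v).
Proof.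
move=> fL; elim: b v => [|x b IH] v /=.
  by move->; have := fL (-1) 0 0; rewrite scaler0 addr0 scaleN1r addNr => ->.
by case=> a [v' [-> /IH h]]; exists a, (f v').
Qed.

Definition FD (S : V -> Prop) := exists b, forall v, S v -> in_span b v.
End Span.

(** * Submodules generated by lowering operators *)

Section Act.
Variables (K : numFieldType) (e1 e2 : sgn) (V : gmodule K e1 e2).
Implicit Types (x y : SDhat K) (u v : V).

Lemma gact0l v : gact 0 v = 0.
Proof.
have := @gact_linl _ _ _ V 1 0 0 v (in_g0 _ _ _) (in_g0 _ _ _).
by rewrite !scale1r addr0 => /(congr1 (fun z => z - gact 0 v)); rewrite subrr addrK => <-.
Qed.
Lemma gactDl x y v : in_g e1 e2 x -> in_g e1 e2 y -> gact (x + y) v = gact x v + gact y v.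
Proof. by move=> gx gy; rewrite -[x in LHS]scale1r gact_linl // scale1r. Qed.
Lemma gact0r x : in_g e1 e2 x -> gact x 0 = 0 :> V.
Proof.
move=> gx; have := gact_linr (g := V) gx (-1) 0 0.
by rewrite scaler0 addr0 scaleN1r addNr.
Qed.
Lemma gactDr x u v : in_g e1 e2 x -> gact x (u + v) = gact x u + gact x v.
Proof. by move=> gx; rewrite -[u in LHS]scale1r gact_linr // scale1r. Qed.
Lemma gactZr a x v : in_g e1 e2 x -> gact x (a *: v) = a *: gact x v.
Proof. by move=> gx; rewrite -[_ *: v]addr0 gact_linr ?gact0r ?addr0. Qed.
Lemma gact_sumr x (I : Type) (s : seq I) (f : I -> V) : in_g e1 e2 x ->
  gact x (\sum_(i <- s) f i) = \sum_(i <- s) gact x (f i).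
Proof. by move=> gx; apply: (big_morph (gact x)) => [u v|]; rewrite (gactDr, gact0r). Qed.
Lemma gact_swap x y v : in_g e1 e2 x -> in_g e1 e2 y ->
  gact x (gact y v) = gact (hbracket x y) v + \sum_(p : bool) \sum_(q : bool)
          (-1) ^+ (p && q) *: gact (hpart q y) (gact (hpart p x) v).
Proof. by move=> gx gy; rewrite gact_bracket // subrK. Qed.
(** Exchanging x and y leaves terms in which v is hit first by a parity component
    of x, which has the degree of x. *)
Lemma gact_kill k x y v : in_g e1 e2 x -> in_g e1 e2 y -> hdeg k x ->
  (forall x', in_g e1 e2 x' -> hdeg k x' -> gact x' v = 0) ->
  gact x (gact y v) = gact (hbracket x y) v.
Proof.
move=> gx gy dx h; rewrite gact_swap // big1 ?addr0 // => p _; rewrite big1 // => q _.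
by rewrite h ?gact0r ?scaler0 //; try apply: in_g_part => //; apply: hdeg_part.
Qed.
End Act.

Section Graded.
Variables (K : numFieldType) (e1 e2 : sgn) (V : graded_gmodule K e1 e2).
Implicit Types (x y : SDhat K) (u v : V) (k i j m : int).

(** The finite set d only has to contain the support of f, so that two
    decompositions can be put over a common index set. *)
Definition dsum (G : int -> V -> Prop) v := exists (d : {fset int}) (f : int -> V),
  [/\ forall k, G k (f k), forall k, k \notin d -> f k = 0 & v = \sum_(k <- d) f k].

Section Dsum.
Variable G : int -> V -> Prop.
Hypothesis G0 : forall k, G k 0.
Hypothesis GL : forall k a u v, G k u -> G k v -> G k (a *: u + v).

Lemma dsum_incl k v : G k v -> dsum G v.
Proof.
move=> h; exists [fset k]%fset, (fun j => if j == k then v else 0); split.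
- by move=> j; case: eqP => [->|].
- by move=> j; rewrite inE => /negPf ->.
- by rewrite big_seq_fset1 eqxx.
Qed.

Lemma dsum0 : dsum G 0.
Proof. exact: (dsum_incl (G0 0)). Qed.

Lemma dsum_lin a u v : dsum G u -> dsum G v -> dsum G (a *: u + v).
Proof.
move=> [d [f [Gf f0 ->]]] [d' [g [Gg g0 ->]]].
exists (d `|` d')%fset, (fun k => a *: f k + g k); split.
- by move=> k; apply: GL.
- by move=> k; rewrite inE negb_or => /andP[/f0 -> /g0 ->]; rewrite scaler0 addr0.
rewrite big_split /= -scaler_sumr; congr (_ *: _ + _).
  by apply: big_fset_incl => [|k _ /f0 //]; apply: fsubsetUl.
by apply: big_fset_incl => [|k _ /g0 //]; apply: fsubsetUr.
Qed.

Lemma dsumZ a u : dsum G u -> dsum G (a *: u).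
Proof. by move=> h; rewrite -[_ *: _]addr0; apply: dsum_lin => //; apply: dsum0. Qed.

Lemma dsumD u v : dsum G u -> dsum G v -> dsum G (u + v).
Proof. by move=> h; rewrite -[u in u + v]scale1r; apply: dsum_lin. Qed.

Lemma dsum_sum (I : Type) (s : seq I) (f : I -> V) :
  (forall a, dsum G (f a)) -> dsum G (\sum_(a <- s) f a).
Proof. by move=> h; apply: big_ind => //; [apply: dsum0|apply: dsumD]. Qed.

(** Decompositions into homogeneous components are unique: subtract v from the
    component of degree k and use that the graded subspaces are independent. *)
Lemma dsum_homog k v : (forall k v, G k v -> gr k v) -> gr k v -> dsum G v -> G k v.
Proof.
move=> Ggr gv [d [f [Gf f0 vE]]].
pose d' := (k |` d)%fset.
pose f' j := (if j == k then -1 else 0) *: v + f j.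
have vE' : v = \sum_(j <- d') f j.
  by rewrite vE; apply: big_fset_incl => [|j _ /f0 //]; apply: fsubsetUr.
have kd : k \in d' by rewrite !inE eqxx.
have := @gr_free _ _ _ V d' f' (fset_uniq _).
have s0 : \sum_(j <- d') f' j = 0.
  rewrite big_split /= -vE' -scaler_suml (bigD1_seq k) ?fset_uniq //= eqxx big1 ?addr0.
    by rewrite scaleN1r addNr.
  by move=> j /negPf ->.
move=> h; have /h {}h : forall j, gr j (f' j).
  move=> j; rewrite /f'; case: eqP => [->|_]; last by rewrite scale0r add0r; apply: Ggr.
  by apply: gr_lin => //; apply: Ggr.
have := h s0 k kd; rewrite /f' eqxx scaleN1r addrC => /eqP; rewrite subr_eq0 => /eqP <-.
exact: Gf.
Qed.
End Dsum.

Section Gen.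
Variables (m : int) (B : V -> Prop).

(** Homogeneous combinations of words y_1 ... y_s u with u in B and all y_i of
    strictly negative degree. Degree-zero letters are left out: B is required to
    absorb them, and without them a word has at most as many letters as its
    degree allows. *)
Inductive low_span : int -> V -> Prop :=
| low_span0 k : low_span k 0
| low_spanB u : B u -> low_span m u
| low_spanL k a u v : low_span k u -> low_span k v -> low_span k (a *: u + v)
| low_spanA k i x u : i < 0 -> in_g e1 e2 x -> hdeg i x -> low_span k u ->
    low_span (k + i) (gact x u).

Lemma low_span_le k v : low_span k v -> v = 0 \/ k <= m.
Proof.
elim=> {k v} [k|u Bu|k a u v _ [->|?] _ [->|?]|k i x u i0 gx _ _ [->|?]]; try by [left|right].
- by left; rewrite scaler0 addr0.
- by left; rewrite gact0r.
- by right; lia.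
Qed.

Hypothesis Bgr : forall u, B u -> gr m u.

Lemma low_span_gr k v : low_span k v -> gr k v.
Proof.
elim=> {k v} [k|u Bu|k a u v _ gu _ gv|k i x u i0 gx dx _ gu].
- exact: gr_zero.
- exact: Bgr.
- exact: gr_lin.
- by rewrite addrC; apply: gr_act.
Qed.

Hypothesis B0 : forall x u, in_g e1 e2 x -> hdeg 0 x -> B u -> B (gact x u).
Hypothesis Bp : forall i x u, 0 < i -> in_g e1 e2 x -> hdeg i x -> B u -> gact x u = 0.

Let gd0 := @dsum0 low_span low_span0.

(** Triangular decomposition without a basis. If v = y u, then x v is [x, y] u
    plus terms y' x' u, with x' and y' parity components of x and y. The
    induction hypothesis for u covers both [x, y] u and x' u whatever the degree
    of x, so that only the case of u in B looks at degrees. *)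
Lemma low_span_act x k v : in_g e1 e2 x -> low_span k v -> dsum low_span (gact x v).
Proof.
move=> gx gv; elim: gv x gx => {k v} [k|u Bu|k a u v _ IHu _ IHv|k i y u i0 gy dy gu IH] x gx.
- by rewrite gact0r.
- move: x gx; apply: homog_ind => [|x y gx gy hx hy|i x gx dx].
  + by rewrite gact0l.
  + by rewrite gactDl //; apply: dsumD => //; apply: low_spanL.
  + have [i0|i0|i0] := ltrgtP i 0.
    * by apply: dsum_incl; [apply: low_span0|exact: (low_spanA i0 gx dx (low_spanB Bu))].
    * by rewrite (Bp i0).
    * by subst i; apply: dsum_incl; [apply: low_span0|apply/low_spanB/B0].
- by rewrite gact_linr //; apply: dsum_lin; [apply: low_spanL|apply: IHu|apply: IHv].
- have dD := @dsumD low_span low_spanL; have dZ := @dsumZ low_span low_span0 low_spanL.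
  have dS := @dsum_sum low_span low_span0 low_spanL.
  rewrite gact_swap //; apply: (dD); first by apply: IH; apply: hbracket_in_g.
  apply: (dS) => p; apply: (dS) => q; apply: (dZ).
  have [d [f [Gf _ ->]]] := IH _ (in_g_part p gx).
  rewrite gact_sumr; last exact: in_g_part.
  apply: (dS) => j; apply: dsum_incl; first exact: low_span0.
  by apply: (low_spanA i0) => //; [apply: in_g_part|apply: hdeg_part].
Qed.

Lemma low_span_submodule : graded_submodule (dsum low_span).
Proof.
split=> [|a u v||v].
- exact: gd0.
- exact: dsum_lin low_spanL _ _ _.
- move=> x v gx [d [f [Gf _ ->]]]; rewrite gact_sumr //.
  by apply: dsum_sum => [|k a u w|k]; [apply: low_span0|apply: low_spanL|apply: low_span_act].
- case=> d [f [Gf _ ->]]; exists d, f; split=> // k; split; first exact: low_span_gr.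
  by apply: dsum_incl; [apply: low_span0|apply: Gf].
Qed.

(** The submodule generated by B is everything by irreducibility, and the
    homogeneous components of its elements are again words applied to B. *)
Lemma low_span_full : irreducible_gmodule V -> (exists u, B u /\ u <> 0) ->
  (forall v, dsum low_span v) /\ (forall k v, gr k v -> low_span k v).
Proof.
move=> [_ irr] [u [Bu u0]].
have full v : dsum low_span v.
  case: (irr _ low_span_submodule) => // /(_ u) z; case: u0; apply: z.
  by apply: dsum_incl; [apply: low_span0|apply: low_spanB].
split=> // k v gv; apply: dsum_homog => //; exact: low_span_gr.
Qed.
End Gen.

Section Highest.
Variables (xi : SDhat K -> K) (w : V).
Hypothesis irrV : irreducible_gmodule V.
Hypothesis hw : highest_vector xi w.
Hypothesis grw : gr 0 w.
Hypothesis w0 : w <> 0.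

Let Bw v := exists a, v = a *: w.

Lemma line_full : (forall v, dsum (low_span 0 Bw) v) /\ (forall k v, gr k v -> low_span 0 Bw k v).
Proof.
apply: low_span_full => //.
- by move=> u [a ->]; rewrite -[_ *: _]addr0; apply: gr_lin => //; apply: gr_zero.
- move=> x u gx dx [a ->]; rewrite gactZr // hw.1 // scalerA; by exists (a * xi x).
- by move=> i x u i0 gx dx [a ->]; rewrite gactZr // (hw.2 i) // scaler0.
- by exists w; split=> //; exists 1; rewrite scale1r.
Qed.

Lemma gr_pos k v : 0 < k -> gr k v -> v = 0.
Proof. by move=> k0 /line_full.2 /low_span_le[//|]; lia. Qed.

(** The vectors of degree k killed by all of g_{>0} form a space stable under
    g_0. A nonzero one would generate L, but what it generates lies in degrees at
    most k < 0 and so misses w. *)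
Lemma primitive_zero k u : k < 0 -> gr k u ->
  (forall i x, 0 < i -> in_g e1 e2 x -> hdeg i x -> gact x u = 0) -> u = 0.
Proof.
move=> k0 gu pu; have [//|nz] := eqVneq u 0.
pose B u := gr k u /\ (forall i x, 0 < i -> in_g e1 e2 x -> hdeg i x -> gact x u = 0).
have [||||_ /(_ 0 w grw)/low_span_le[//|]] := @low_span_full k B _ _ _ irrV; last by lia.
- by move=> v [].
- move=> x v gx dx [gv pv]; split; first by have := gr_act gx dx gv; rewrite add0r.
  move=> i y i0 gy dy; rewrite (@gact_kill _ _ _ _ i) //; last by move=> *; apply: (pv i).
  apply: (pv i) => //; first exact: hbracket_in_g.
  by have := hdeg_bracket dy dx; rewrite addr0.
- by move=> i x v i0 gx dx [_ pv]; apply: (pv i).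
- by exists u; split=> //; apply/eqP.
Qed.

Definition orbit_FD u := forall j, j < 0 ->
  FD (fun v => exists x, [/\ in_g e1 e2 x, hdeg j x & v = gact x u]).

Hypothesis FDw : orbit_FD w.

Lemma orbit_FD_lin a u v : orbit_FD u -> orbit_FD v -> orbit_FD (a *: u + v).
Proof.
move=> hu hv j j0; have [b hb] := hu j j0; have [b' hb'] := hv j j0.
exists (b ++ b') => _ [x [gx dx ->]]; rewrite gact_linr //.
apply: in_span_lin; [apply: in_span_catl|apply: in_span_catr]; [apply: hb|apply: hb'];
  by exists x.
Qed.

Lemma orbit_FD0 : orbit_FD 0.
Proof. by move=> j _; exists [::] => _ [x [gx _ ->]]; rewrite gact0r. Qed.

(** In x y u = [x, y] u + (terms y' x' u) the element [x, y] has a fixed negative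
    degree, and x' u ranges over a finite-dimensional space to which the fixed
    operators y' are applied. *)
Lemma orbit_FD_low_span k u : low_span 0 Bw k u -> orbit_FD u.
Proof.
elim=> {k u} [k|u [a ->]|k a u v _ hu _ hv|k i y u i0 gy dy _ hu].
- exact: orbit_FD0.
- by rewrite -[_ *: _]addr0; apply: orbit_FD_lin => //; apply: orbit_FD0.
- exact: orbit_FD_lin.
move=> j j0; have [b hb] := hu (j + i) ltac:(lia); have [b' hb'] := hu j j0.
exists (b ++ (map (gact (hpart false y)) b' ++ map (gact (hpart true y)) b')).
move=> _ [x [gx dx ->]]; rewrite gact_swap //; apply: in_spanD.
  apply/in_span_catl/hb; exists (hbracket x y); split=> //; first exact: hbracket_in_g.
  exact: hdeg_bracket.
apply: in_span_catr; apply: big_ind => [||p _]; [exact: in_span0|exact: in_spanD|].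
have hx : in_span b' (gact (hpart p x) u).
  by apply: hb'; exists (hpart p x); split=> //; [apply: in_g_part|apply: hdeg_part].
apply: big_ind => [||q _]; [exact: in_span0|exact: in_spanD|apply: in_spanZ].
have L q' := in_span_map (gact_linr (in_g_part q' gy)) hx.
by case: q; [apply/in_span_catr|apply/in_span_catl]; apply: L.
Qed.

Lemma orbit_FD_all u : orbit_FD u.
Proof.
have [d [f [Gf _ ->]]] := line_full.1 u.
apply: big_ind => [|v v' hv|k _]; [exact: orbit_FD0| |exact: orbit_FD_low_span (Gf k)].
by rewrite -[v in v + v']scale1r; apply: orbit_FD_lin.
Qed.

Lemma act_FD (b : seq V) j : j < 0 -> exists b', forall x e, in_g e1 e2 x -> hdeg j x ->
  in_span b e -> in_span b' (gact x e).
Proof.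
move=> j0; elim: b => [|u b [b' IH]]; first by exists [::] => x e gx _ /= ->; rewrite gact0r.
have [b'' hb] := orbit_FD_all u j0; exists (b' ++ b'') => x e gx dx /= [a [v [-> hv]]].
rewrite gact_linr //; apply: in_span_lin; last by apply/in_span_catl/IH.
by apply/in_span_catr/hb; exists x.
Qed.

(** Induction on the degree: up to multiples of w, a vector of degree -N is a sum
    of y u with y of degree -j < 0 and u of degree -N + j, hence in a known
    finite-dimensional space, and [act_FD] bounds the y u for each j. *)
Lemma gr_FD k : FD (gr (g := V) k).
Proof.
have [k0|k0] := ltrP 0 k; first by exists [::] => v /(gr_pos k0).
have [N ->] : exists N : nat, k = - N%:Z by exists `|k|%N; lia.
move: N {k k0}; suff H n (N : nat) : (N <= n)%N -> FD (low_span 0 Bw (- N%:Z)).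
  by move=> N; have [b hb] := H N N (leqnn N); exists b => v /line_full.2 /hb.
elim: n N => [|n IH] N hN.
  exists [:: w] => v gv; have kE : - N%:Z = 0 :> int by lia.
  elim: gv kE => {v} [k _|u [a ->] _|k a u v _ hu _ hv kE|k i x u i0 gx dx gu _ kE].
  - exact: in_span0.
  - by exists a, 0; rewrite addr0.
  - by apply: in_span_lin; [apply: hu|apply: hv].
  - case: (low_span_le gu) => [->|]; first by rewrite gact0r //; apply: in_span0.
    by lia.
have [b hb] : exists b, forall (j : nat) x u, (j < n.+1)%N -> in_g e1 e2 x ->
    hdeg (- (j.+1)%:Z) x -> low_span 0 Bw (j.+1%:Z - N%:Z) u -> in_span b (gact x u).
  move: (n.+1); elim=> [|l [b hb]]; first by exists [::].
  have [lN|lN] := leqP l.+1 N; last first.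
    exists b => j x u; rewrite ltnS leq_eqVlt => /orP[/eqP ->|]; last exact: hb.
    by move=> gx dx /low_span_le[->|]; [rewrite gact0r // => *; apply: in_span0|lia].
  have [b0 hb0] := IH (N - l.+1)%N ltac:(lia).
  have [b' hb'] := @act_FD b0 (- l.+1%:Z) ltac:(lia).
  exists (b ++ b') => j x u; rewrite ltnS leq_eqVlt => /orP[/eqP ->|jl] gx dx gu.
    apply/in_span_catr/hb' => //; apply: hb0.
    by have -> : - (N - l.+1)%N%:Z = l.+1%:Z - N%:Z by lia.
  by apply/in_span_catl/(hb j).
exists (w :: b) => v gv; move: {-2}(- N%:Z) (erefl (- N%:Z)) gv => k kE gv.
elim: gv kE => {v k} [k _|u [a ->] _|k a u v _ hu _ hv kE|k i x u i0 gx dx gu _ kE].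
- exact: in_span0.
- by exists a, 0; rewrite addr0; split=> //; apply: in_span0.
- by apply: in_span_lin; [apply: hu|apply: hv].
case: (low_span_le gu) => [->|k0]; first by rewrite gact0r //; apply: in_span0.
have [j jE] : exists j : nat, i = - j.+1%:Z by exists `|i|.-1%N; lia.
apply: (@in_span_catr _ _ [:: w]); apply: (hb j); rewrite ?jE //.
- by lia.
- by rewrite -jE.
- by have -> : j.+1%:Z - N%:Z = k by lia.
Qed.
End Highest.
End Graded.

(** * Brackets of the generators *)

Section Brackets.
Variables (K : numFieldType) (e1 e2 : sgn).
Implicit Types (r s k : int) (f g h : {poly K}) (x y : SD K) (X Y : SDhat K).
Local Notation gdiag := (@gdiag K e1 e2).
Local Notation gup := (@gup K e1 e2).
Local Notation glo := (@glo K e1 e2).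
Local Notation skew := (@skew K e1 e2).
Local Notation upent := (@upent K e1 e2).
Local Notation loent := (@loent K e1 e2).
Local Notation s1 r := ((sgnv K e1 ^ r)).
Local Notation s2 := (sgnv K e2).

Lemma sgn12 r : (s1 r * s2) * (s1 r * s2) = 1.
Proof. by rewrite mulrACA sgnvX2 sgnv2 mulr1. Qed.

Lemma refl_upent r f : refl r (upent r f) = (s1 r * s2)%:P * upent r f.
Proof. by rewrite /upent reflD reflM reflC reflK mulrDr mulrA -polyCM sgn12 mul1r addrC. Qed.
Lemma refl_loent r f : refl r (loent r f) = - ((s1 r * s2)%:P * loent r f).
Proof.
by rewrite /loent reflD reflN reflM reflC reflK mulrBr mulrA -polyCM sgn12 mul1r opprB.
Qed.

Lemma upent_sym r f : refl r f = (s1 r * s2)%:P * f -> upent r f = f *+ 2.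
Proof. by move=> h; rewrite /upent h mulrA -polyCM sgn12 mul1r mulr2n. Qed.
Lemma loent_sym r f : refl r f = - ((s1 r * s2)%:P * f) -> loent r f = f *+ 2.
Proof. by move=> h; rewrite /loent h mulrN opprK mulrA -polyCM sgn12 mul1r mulr2n. Qed.

Lemma upent_mul r f g : refl r f = (s1 r * s2)%:P * f -> upent r (f * g) = f * (g + refl r g).
Proof. by move=> h; rewrite /upent reflM h !mulrA -polyCM sgn12 mul1r mulrDr. Qed.
Lemma loent_mul r f g : refl r f = - ((s1 r * s2)%:P * f) -> loent r (f * g) = f * (g + refl r g).
Proof. by move=> h; rewrite /loent reflM h mulNr mulrN opprK !mulrA -polyCM sgn12 mul1r mulrDr. Qed.

(** Membership in the subalgebra determines the lower right entry from the upper
    left one. *)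
Lemma gdiag_of_diag r f h :
  sigma e1 e2 (mono r (f *: M0 K + h *: M1 K)) = - mono r (f *: M0 K + h *: M1 K) ->
  mono r (f *: M0 K + h *: M1 K) = gdiag r f.
Proof.
rewrite sigma_mono -monoN => /(congr1 (fun x => coef x r 1 1)).
rewrite !coef_mono eqxx !mulr1n sigmx11 !mxE /= !mulr0 !mulr1 addr0 add0r => hE.
by rewrite gdiagE hE scaleNr opprK.
Qed.

Lemma hbracket_deg k l x y : sdeg k x -> sdeg l y -> k + l != 0 ->
  hbracket (hemb x) (hemb y) = hemb (sbracket x y).
Proof.
move=> dx dy kl; congr pair; apply/eqP/negPn/negP => /(Psi_sdeg dx dy) /eqP.
by rewrite (negPf kl).
Qed.

Let shp00 f : shp 0 f = f.
Proof. by rewrite /shp addr0 comp_polyXr. Qed.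

Lemma hbracket_diag_up r f g : r * 2 - 1 != 0 ->
  hbracket (hemb (gdiag r f)) (hemb (gup 0 g)) = hemb (gup r (f * upent 0 g)).
Proof.
move=> r0; rewrite (@hbracket_deg (r * 2) (-1)).
- rewrite skew_bracket; last exact: (in_g_skew e1 e2 _).
  rewrite gupE sbracket_delta addr0 shp00 mul_delta_mx mul_delta_mx_0 //.
  by rewrite scaler0 subr0.
- by case: (hdeg_gdiag e1 e2 r f).
- by case: (hdeg_gup e1 e2 0 g).
- by [].
Qed.

Lemma hbracket_diag_lo r f g : r != 0 ->
  hbracket (hemb (gdiag r f)) (hemb (glo (-1) g)) =
  hemb (glo (r - 1) (- (shp r (loent (-1) g) * f))).
Proof.
move=> r0; rewrite (@hbracket_deg (r * 2) (-1)).
- rewrite skew_bracket; last exact: (in_g_skew e1 e2 _).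
  rewrite gloE sbracket_delta mul_delta_mx mul_delta_mx_0 //.
  by rewrite scaler0 sub0r expr0 mul1r -scaleNr.
- by case: (hdeg_gdiag e1 e2 r f).
- by case: (hdeg_glo e1 e2 (-1) g).
- lia.
Qed.

Lemma hbracket_up_lo r f g : r != 0 ->
  hbracket (hemb (gup 0 g)) (hemb (glo r f)) = hemb (gdiag r (shp r (upent 0 g) * loent r f)).
Proof.
move=> r0; rewrite (@hbracket_deg (-1) (r * 2 + 1)).
- have: sigma e1 e2 (sbracket (gup 0 g) (glo r f)) = - sbracket (gup 0 g) (glo r f).
    by apply: sbracket_closed; apply: (in_g_skew e1 e2 _).
  rewrite gupE gloE sbracket_delta !mul_delta_mx add0r shp00 /= expr1 mulN1r scaleNr opprK.
  by move=> h; rewrite gdiag_of_diag.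
- by case: (hdeg_gup e1 e2 0 g).
- by case: (hdeg_glo e1 e2 r f).
- lia.
Qed.

Lemma hbracket_lo0_up0 f g :
  hbracket (hemb (glo 0 f)) (hemb (gup 0 g)) = hemb (gdiag 0 (loent 0 f * upent 0 g)).
Proof.
rewrite /hbracket /= -/(hemb _); congr pair.
  have: sigma e1 e2 (sbracket (glo 0 f) (gup 0 g)) = - sbracket (glo 0 f) (gup 0 g).
    by apply: sbracket_closed; apply: (in_g_skew e1 e2 _).
  rewrite gupE gloE sbracket_delta !mul_delta_mx add0r !shp00 /= expr1 mulN1r scaleNr opprK addrC.
  by move=> h; rewrite gdiag_of_diag // mulrC.
by rewrite gupE gloE Psi_mono addr0 eqxx /= psi_pos0.
Qed.

(** The central term is the value at 0 of the polynomial of the diagonal part, as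
    [shp (-1)] moves -1 to 0. That polynomial is odd, so that the central term
    will turn out to be 0 by [odd_horner0]. *)
Lemma hbracket_up1_lo1 f g :
  hbracket (hemb (gup 1 f)) (hemb (glo (-1) g)) =
  (gdiag 0 (shp (-1) (upent 1 f) * loent (-1) g), (upent 1 f).[-1] * (loent (-1) g).[0]).
Proof.
congr pair.
  have: sigma e1 e2 (sbracket (gup 1 f) (glo (-1) g)) = - sbracket (gup 1 f) (glo (-1) g).
    by apply: sbracket_closed; apply: (in_g_skew e1 e2 _).
  rewrite gupE gloE sbracket_delta !mul_delta_mx subrr /= expr1 mulN1r scaleNr opprK.
  by move=> h; rewrite gdiag_of_diag.
rewrite /= gupE gloE Psi_mono subrr eqxx /= /psi_pos big_nat1 /= !mxE /=.
by rewrite !(mulr0, mulr1, horner0, mul0r, subr0, add0r) addNr.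
Qed.

Lemma hbracket_up1_up0 f g : hbracket (hemb (gup 1 f)) (hemb (gup 0 g)) = 0.
Proof.
by rewrite !gupE hbracket_mono // sbracket_delta mul_delta_mx_0 // !scaler0 subrr mono0.
Qed.

Lemma hbracket_lo0_lo1 f g : hbracket (hemb (glo 0 f)) (hemb (glo (-1) g)) = 0.
Proof.
by rewrite !gloE hbracket_mono // sbracket_delta mul_delta_mx_0 // !scaler0 subrr mono0.
Qed.

Lemma hpart_skew p r f (i j : 'I_2) : hpart p (hemb (skew (mono r (f *: delta_mx i j)))) =
  if (i != j) == p then hemb (skew (mono r (f *: delta_mx i j))) else 0.
Proof.
rewrite /hpart /= if_same part_skew part_delta.
by case: ifP => // _; rewrite skew0.
Qed.
End Brackets.

Section Killing.
Variables (K : numFieldType) (e1 e2 : sgn) (V : gmodule K e1 e2) (w : V).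
Implicit Types (r s k : int) (f g h : {poly K}) (x y : SD K) (X Y : SDhat K).
Local Notation gdiag := (@gdiag K e1 e2).
Local Notation gup := (@gup K e1 e2).
Local Notation glo := (@glo K e1 e2).
Local Notation skew := (@skew K e1 e2).
Local Notation s1 r := ((sgnv K e1 ^ r)).
Local Notation s2 := (sgnv K e2).

Definition kills x := gact (hemb x) w = 0.

(** The elements considered are homogeneous for the parity, so that killing w
    passes to their parity components, to which the bracket formula refers. *)
Lemma kills_bracket r s f g (i j i' j' : 'I_2) :
  let x := skew (mono r (f *: delta_mx i j)) in
  let y := skew (mono s (g *: delta_mx i' j')) in
  kills x -> kills y -> gact (hbracket (hemb x) (hemb y)) w = 0.
Proof.
move=> x y kx ky; have gx := in_g_skew e1 e2 (mono r (f *: delta_mx i j)).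
have gy := in_g_skew e1 e2 (mono s (g *: delta_mx i' j')).
rewrite gact_bracket // ky gact0r // sub0r big1 ?oppr0 // => p _; rewrite big1 // => q _.
rewrite !hpart_skew; case: ((i != j) == p); last first.
  by rewrite gact0l; case: ifP => _; rewrite gact0r ?scaler0 //; apply: in_g0.
by rewrite [gact (hemb _) w]kx; case: ifP => _; rewrite gact0r ?scaler0 //; apply: in_g0.
Qed.

(** Finite codimension of the kernel of f |-> E f w, in a form that survives the
    multiplications of f that brackets perform. *)
Definition ideal_kills (E : {poly K} -> SD K) := exists Q, Q != 0 /\ forall f, kills (E (Q * f)).

Lemma shpK s : cancel (shp s) (shp (- s) : {poly K} -> _).
Proof.
move=> f; rewrite /shp -comp_polyA comp_polyD comp_polyX rmorph_int /= -addrA -intrD addNr.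
by rewrite addr0 comp_polyXr.
Qed.

Lemma shp_neq0 s f : f != 0 -> shp s f != 0.
Proof. by apply: contra_neq => h; rewrite -(shpK s f) h shp0. Qed.

Lemma refl_neq0 r f : f != 0 -> refl r f != 0.
Proof. by apply: contra_neq => h; rewrite -(reflK r f) h refl0. Qed.
End Killing.

(** * Linear maps on polynomials *)

Section LinearPoly.
Variables (K : fieldType) (V : lmodType K) (T : {poly K} -> V).
Hypothesis TL : forall a f g, T (a *: f + g) = a *: T f + T g.

Lemma polymap0 : T 0 = 0.
Proof. by have := TL (-1) 0 0; rewrite scaler0 addr0 scaleN1r addNr. Qed.
Lemma polymapD f g : T (f + g) = T f + T g.
Proof. by rewrite -[f in LHS]scale1r TL scale1r. Qed.
Lemma polymapZ a f : T (a *: f) = a *: T f.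
Proof. by rewrite -[_ *: f]addr0 TL polymap0 addr0. Qed.
Lemma polymap_sum (I : Type) (s : seq I) (P : pred I) (f : I -> {poly K}) :
  T (\sum_(i <- s | P i) f i) = \sum_(i <- s | P i) T (f i).
Proof. exact: (big_morph T polymapD polymap0). Qed.

Lemma poly_shift_exp (c : K) f : exists a : nat -> K, exists n,
  f = \sum_(i < n) a i *: ('X + c%:P) ^+ i.
Proof.
pose g := f \Po ('X - c%:P); exists (fun i => g`_i), (size g).
by rewrite -comp_polyE /g -comp_polyA comp_polyB comp_polyX comp_polyC addrK comp_polyXr.
Qed.

Lemma polymap_eq0 (c : K) : (forall n, T (('X + c%:P) ^+ n) = 0) -> forall f, T f = 0.
Proof.
move=> h f; have [a [n ->]] := poly_shift_exp c f.
by rewrite polymap_sum big1 // => i _; rewrite polymapZ h scaler0.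
Qed.

(** The identity (y + d)^2 = y^2 + 2 d y + d^2 expresses the odd powers of y by
    products of polynomials that are even about one of two distinct centres. *)
Lemma polymap_two_centres (c d : K) : (2%:R : K) != 0 -> d != 0 -> let y := 'X + c%:P in
  (forall i, T (y ^+ (i * 2)) = 0) -> (forall i, T ((y + d%:P) ^+ 2 * y ^+ (i * 2)) = 0) ->
  forall f, T f = 0.
Proof.
move=> n2 d0 y h1 h2; apply: (@polymap_eq0 c) => n; rewrite -/y.
rewrite -(odd_double_half n) -muln2; case: (odd n) => /=; rewrite ?add0n // add1n.
have : T ((y + d%:P) ^+ 2 * y ^+ (n./2 * 2)) = (d *+ 2) *: T (y ^+ (n./2 * 2).+1).
  have -> : (y + d%:P) ^+ 2 * y ^+ (n./2 * 2) = y ^+ (n./2.+1 * 2) +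
      ((d *+ 2) *: y ^+ (n./2 * 2).+1 + (d ^+ 2) *: y ^+ (n./2 * 2)).
    rewrite mulSn exprD !exprS expr0 -!mul_polyC rmorphMn /= !rmorphM /= rmorph1; ring.
  by rewrite !polymapD !polymapZ !h1 scaler0 add0r addr0.
by rewrite h2 => /esym/eqP; rewrite scaler_eq0 -mulr_natr mulf_eq0 (negPf n2) (negPf d0) => /eqP.
Qed.

Lemma in_span_mem (b : seq V) x : x \in b -> in_span b x.
Proof.
elim: b => //= y b IH; rewrite inE => /orP[/eqP ->|/IH h].
  by exists 1, 0; rewrite scale1r addr0; split=> //; apply: in_span0.
by exists 0, x; rewrite scale0r add0r.
Qed.

(** f and its remainder modulo Q have the same image, and remainders have bounded
    degree. *)
Lemma cofinite_FD Q : Q != 0 -> (forall f, T (Q * f) = 0) ->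
  exists b, forall f, in_span b (T f).
Proof.
move=> Q0 hQ; exists [seq T 'X^i | i <- iota 0 (size Q)] => f.
rewrite (divp_eq f Q) polymapD mulrC hQ add0r.
have sm : (size (modp f Q) <= size Q)%N by apply/ltnW; rewrite ltn_modp.
rewrite -[f %% Q]coefK poly_def polymap_sum; apply: big_ind => [||i _].
- exact: in_span0.
- exact: in_spanD.
rewrite polymapZ; apply/in_spanZ/in_span_mem/map_f; rewrite mem_iota add0n /=.
exact: leq_trans sm.
Qed.

(** The images of 1, 'X, ..., 'X^N with N the size of b are N + 1 combinations of
    N vectors, so the matrix of their coefficients has a left kernel vector. *)
Lemma FD_kernel b : (forall f, in_span b (T f)) -> exists2 p, p != 0 & T p = 0.
Proof.
move=> hb; pose N := size b.
have /(_ _)/in_spanP-/fin_all_exists[c hc] : forall i : 'I_N.+1, in_span b (T 'X^i) by [].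
pose C : 'M[K]_(N.+1, N) := \matrix_(i, j) c i j.
have : kermx C != 0.
  by rewrite -mxrank_eq0 mxrank_ker -lt0n subn_gt0 ltnS; apply: rank_leq_col.
case/rowV0Pn => v /sub_kermxP vC v0; exists (rVpoly v).
  by apply: contra v0 => /eqP h; rewrite -(rVpolyK v) h linear0.
rewrite -[rVpoly v]coefK poly_def polymap_sum.
have -> : \sum_(i < size (rVpoly v)) T ((rVpoly v)`_i *: 'X^i) =
   \sum_(i < N.+1) v 0 i *: T 'X^i.
  transitivity (\sum_(i < N.+1) T ((rVpoly v)`_i *: 'X^i)); last first.
    by apply: eq_bigr => i _; rewrite coef_rVpoly_ord polymapZ.
  rewrite (big_ord_widen N.+1 (fun i => T ((rVpoly v)`_i *: 'X^i))) ?size_poly //.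
  rewrite big_mkcond /=; apply: eq_bigr => i _; case: ltnP => // h.
  by rewrite nth_default // scale0r polymap0.
transitivity (\sum_(j < N) (v *m C) 0 j *: b`_j); last first.
  by rewrite vC big1 // => j _; rewrite mxE scale0r.
under eq_bigr do rewrite hc scaler_sumr.
rewrite exchange_big; apply: eq_bigr => j _; rewrite mxE scaler_suml.
by apply: eq_bigr => i _; rewrite mxE scalerA.
Qed.
End LinearPoly.

(** * Propagation to all degrees *)

Section Propagation.
Variables (K : numFieldType) (e1 e2 : sgn) (V : gmodule K e1 e2) (w : V).
Implicit Types (r s k : int) (f g h : {poly K}).
Local Notation gdiag := (@gdiag K e1 e2).
Local Notation gup := (@gup K e1 e2).
Local Notation glo := (@glo K e1 e2).
Local Notation upent := (@upent K e1 e2).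
Local Notation loent := (@loent K e1 e2).
Local Notation kills := (@kills K e1 e2 V w).
Local Notation ideal_kills := (@ideal_kills K e1 e2 V w).
Local Notation s1 r := ((sgnv K e1 ^ r)).
Local Notation s2 := (sgnv K e2).

Let two0 : 2%:R != 0 :> K.
Proof. by rewrite pnatr_eq0. Qed.

Let dbl_neq0 f : f != 0 -> f *+ 2 != 0.
Proof. by rewrite -scaler_nat scaler_eq0 negb_or two0. Qed.

Section Base.
Variable b : {poly K}.
Hypotheses (b0 : b != 0) (bs : refl 0 b = (s1 0 * s2)%:P * b)
  (kb : forall f, kills (gup 0 (b * f))).

Lemma ideal_kills_gup r : r * 2 - 1 != 0 -> ideal_kills (gdiag r) -> ideal_kills (gup r).
Proof.
move=> r0 [Q [Q0 hQ]]; exists (Q * (b *+ 2)); split.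
  by rewrite mulf_neq0 ?dbl_neq0.
move=> f; have := kills_bracket (hQ f) (kb 1).
rewrite -/(gdiag r _) -/(gup 0 _) hbracket_diag_up // mulr1 upent_sym // => h.
by rewrite mulrAC.
Qed.

(** The bracket of [gup 0 g] and [glo r f] is diagonal with entry a product of
    [shp r (upent 0 g)] and [loent r f], both confined to a parity. But the first
    is symmetric about - r - 1/2 and the second about - (r + 1) / 2, which differ
    by r / 2, so such products span an ideal by [polymap_two_centres]. *)
Lemma ideal_kills_gdiag r : r != 0 -> ideal_kills (glo r) -> ideal_kills (gdiag r).
Proof.
move=> r0 [Q [Q0 hQ]].
(* - c is the centre of refl r, and d its distance to the centre of shp r b. *)
pose c : K := (r + 1)%:~R / 2%:R; pose d : K := r%:~R / 2%:R.
pose y : {poly K} := 'X + c%:P; pose s : K := s1 r * s2.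
have cc : c + c = (r + 1)%:~R by rewrite -mulr2n -mulr_natr /c divfK.
have dd : d + d = r%:~R by rewrite -mulr2n -mulr_natr /d divfK.
have ss : s * s = 1 by apply: sgn12.
have ry : refl r y = - y.
  have -> : refl r y = - 'X - (c + c)%:P + c%:P.
    by rewrite /refl /y comp_polyD comp_polyX comp_polyC cc rmorph_int.
  by rewrite rmorphD /y /=; ring.
(* P is 2 y or 2 according to the sign s: it gives Q * refl Q * P the symmetry
   of an entry below the diagonal. *)
pose P := 1 + y - s%:P * (1 - y).
have P0 : P != 0.
  apply/eqP => PE.
  have := congr1 (fun p => p.[- c]) PE; have := congr1 (fun p => p.[1 - c]) PE.
  rewrite /P /y !hornerE /= !addNr !subrK !(subr0, addr0) subrr mulr0 mulr1 subr0.
  by move=> h; move: two0; rewrite -[2%:R]/(1 + 1) h eqxx.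
pose M := shp r b * (Q * refl r Q * P) *+ 2.
have M0 : M != 0.
  by rewrite /M dbl_neq0 // !mulf_neq0 ?shp_neq0 ?refl_neq0.
exists M; split=> // f.
pose T f := gact (hemb (gdiag r (M * f))) w.
have TL a g h : T (a *: g + h) = a *: T g + T h.
  rewrite /T mulrDr -scalerAr gdiagD gdiagZ hembD hembZ gact_linl //; exact: in_g_skew.
have T2 a a' : refl 0 a = a -> refl r a' = a' -> T (shp r a * a') = 0.
  move=> ha ha'; have := kills_bracket (kb a) (hQ (refl r Q * (1 + y) * a')).
  rewrite -/(gup 0 _) -/(glo r _) hbracket_up_lo // upent_mul // ha => h; rewrite /T -[RHS]h.
  congr (gact (hemb (gdiag r _)) w); rewrite /M shpM /loent !reflM reflK ha' reflD ry.
  rewrite [refl r 1]reflC [shp r (a + a)](rmorphD (comp_poly ('X + r%:~R))) /= -/(shp r a) -/s /P.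
  ring.
have ryX i : refl r (y ^+ (i * 2)) = y ^+ (i * 2).
  transitivity (refl r y ^+ (i * 2)); first exact: rmorphXn.
  by rewrite ry exprNn mulnC exprM sqrrN !expr1n mul1r.
apply: (polymap_two_centres TL (c := c) (d := d)) => //.
- by rewrite mulf_neq0 ?intr_eq0 // invr_eq0.
- move=> i; rewrite -/y -[_ ^+ _]mul1r; have <- : shp r 1 = 1 :> {poly K} by apply: shpC.
  by apply: T2 => //; apply: reflC.
move=> i; rewrite -/y; pose u : {poly K} := 'X + (2%:R^-1)%:P.
have hh : 2%:R^-1 + 2%:R^-1 = 1 :> K by rewrite -mulr2n -[_ *+ 2]mulr_natr mulVf.
have -> : (y + d%:P) ^+ 2 = shp r (u ^+ 2).
  rewrite expr2 shpM /u /shp comp_polyD comp_polyX comp_polyC /y.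
  have -> : c = d + 2%:R^-1 by rewrite /c intrD mulrDl mul1r.
  have -> : r%:~R = (d + d)%:P by rewrite dd rmorph_int.
  by rewrite !rmorphD /=; ring.
apply: T2 => //; rewrite expr2 reflM.
have -> : refl 0 u = - u.
  have -> : refl 0 u = - 'X - (2%:R^-1 + 2%:R^-1)%:P + (2%:R^-1)%:P.
    by rewrite /refl /u comp_polyD comp_polyX comp_polyC hh add0r.
  by rewrite rmorphD /u /=; ring.
by rewrite mulrNN.
Qed.
End Base.

Lemma ideal_kills_glo (a : {poly K}) r : a != 0 -> refl (-1) a = - ((s1 (-1) * s2)%:P * a) ->
  kills (glo (-1) a) -> r != 0 -> ideal_kills (gdiag r) -> ideal_kills (glo (r - 1)).
Proof.
move=> a0 sa ka r0 [Q [Q0 hQ]]; exists (- (shp r (a *+ 2) * Q)); split.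
  by rewrite oppr_eq0 mulf_neq0 // shp_neq0 // dbl_neq0.
move=> f; have := kills_bracket (hQ f) ka.
rewrite -/(gdiag r _) -/(glo (-1) _) hbracket_diag_lo // loent_sym // => h.
by rewrite mulNr -mulrA.
Qed.

(** In negative degrees the killing ideals are built in the order [glo (-1)],
    [gdiag (-1)], [gup (-1)], [glo (-2)], [gdiag (-2)] and so on, each from
    previous ones by brackets with [gup 0 b] or [glo (-1) a]. *)
Lemma ideal_kills_all (a b : {poly K}) : a != 0 -> b != 0 ->
  refl (-1) a = - ((s1 (-1) * s2)%:P * a) -> refl 0 b = (s1 0 * s2)%:P * b ->
  (forall f, kills (glo (-1) (a * f))) -> (forall f, kills (gup 0 (b * f))) ->
  (forall k, k < 0 -> [/\ ideal_kills (glo k), ideal_kills (gdiag k) & ideal_kills (gup k)]) /\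
  ideal_kills (gup 0).
Proof.
move=> a0 b0 sa sb ka kb; split; last by exists b.
move=> k k0; have [n ->] : exists n : nat, k = - n.+1%:Z by exists (`|k|.-1)%N; lia.
elim: n {k k0} => [|n [_ IH0 _]].
  have k1 : ideal_kills (glo (-1)) by exists a.
  have k2 := ideal_kills_gdiag b0 sb kb (r := -1) isT k1; split=> //.
  exact: (ideal_kills_gup b0 sb kb).
have k1 : ideal_kills (glo (- n.+2%:Z)).
  have -> : - n.+2%:Z = - n.+1%:Z - 1 by lia.
  by apply: (ideal_kills_glo a0 sa) => //; rewrite -[a]mulr1; apply: ka.
have k2 : ideal_kills (gdiag (- n.+2%:Z)) by apply: (ideal_kills_gdiag b0 sb kb) => //; lia.
by split=> //; apply: (ideal_kills_gup b0 sb kb) => //; lia.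
Qed.

Lemma ideal_kills_FD (E : {poly K} -> SD K) :
  (forall a f g, E (a *: f + g) = a *: E f + E g) ->
  (forall f, in_g e1 e2 (hemb (E f))) -> ideal_kills E ->
  exists b, forall f, in_span b (gact (hemb (E f)) w).
Proof.
move=> EL gE [Q [Q0 hQ]]; apply: (cofinite_FD (T := fun f => gact (hemb (E f)) w)) Q0 hQ.
by move=> a f g; rewrite EL hembD hembZ gact_linl.
Qed.
End Propagation.

(** * The highest weight conditions in degree -1/2 *)

Section Weight.
Variables (K : numFieldType) (e1 e2 : sgn) (xi : SDhat K -> K).
Implicit Types (r s k : int) (f g h p q : {poly K}).
Local Notation gdiag := (@gdiag K e1 e2).
Local Notation gup := (@gup K e1 e2).
Local Notation glo := (@glo K e1 e2).
Local Notation upent := (@upent K e1 e2).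
Local Notation loent := (@loent K e1 e2).
Local Notation s1 r := ((sgnv K e1 ^ r)).
Local Notation s2 := (sgnv K e2).
Hypothesis wxi : weight e1 e2 xi.

(** The weight as a linear form on polynomials; [gdiag 0 f] is the element
    [g0elt f] of degree zero. *)
Definition dwt f : K^o := xi (hemb (gdiag 0 f)).

Lemma dwt_lin a f g : dwt (a *: f + g) = a *: dwt f + dwt g.
Proof.
rewrite /dwt gdiagD gdiagZ hembD hembZ; have gE f' := in_g_skew e1 e2 (mono 0 (f' *: M0 K)).
by apply: wxi; [apply: gE|apply: (hdeg_gdiag e1 e2 0)|apply: gE|apply: (hdeg_gdiag e1 e2 0)].
Qed.

Let lamZ := polymapZ dwt_lin.

(** The weight vanishes on all brackets of [gup 0 b] with elements of degree 1/2;
    [lo_cond] is the same for [glo (-1) a]. *)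
Definition up_cond b := forall q, refl 0 q = - ((s1 0 * s2)%:P * q) -> dwt (b * q) = 0.
Definition lo_cond a := forall q, refl (-1) q = (s1 (-1) * s2)%:P * q -> dwt (a * q) = 0.

Lemma refl_shp_upent f :
  refl (-1) (shp (-1) (upent 1 f)) = (s1 (-1) * s2)%:P * shp (-1) (upent 1 f).
Proof.
have -> : refl (-1) (shp (-1) (upent 1 f)) = refl 0 (upent 1 f).
  by have := refl_shift 0 (-1) (upent 1 f); rewrite add0r.
have -> : refl 0 (upent 1 f) = shp (-1) (refl 1 (upent 1 f)).
  by rewrite shp_refl addNr.
rewrite refl_upent shpM shpC; congr ((_ * _)%:P * _); by case: e1; rewrite ?exprN1 ?invr1 ?invrN1.
Qed.

Lemma odd_horner0 p : refl (-1) p = - p -> p.[0] = 0.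
Proof.
move=> /(congr1 (horner^~ 0)); rewrite /refl addNr horner_comp !hornerE ?oppr0 ?addr0 => /eqP.
by rewrite -addr_eq0 -mulr2n -mulr_natr mulf_eq0 pnatr_eq0 orbF => /eqP.
Qed.

Lemma horner_shp s f (c : K) : (shp s f).[c] = f.[c + s%:~R].
Proof. by rewrite /shp horner_comp -[_%:~R](rmorph_int polyC) !hornerE. Qed.

Section Module.
Variables (V : graded_gmodule K e1 e2) (w : V).
Hypothesis irrV : irreducible_gmodule V.
Hypothesis hw : highest_vector xi w.
Hypothesis grw : gr 0 w.
Hypothesis w0 : w <> 0.
Local Notation kills := (@kills K e1 e2 V w).

Let gE (x : SD K) : in_g e1 e2 (hemb (skew e1 e2 x)) := in_g_skew e1 e2 x.

Lemma gact_gdiag f : gact (hemb (gdiag 0 f)) w = dwt f *: w.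
Proof. by apply: hw.1; [apply: gE|apply: (hdeg_gdiag e1 e2 0)]. Qed.

(** X w has degree -1/2, so only degree 1/2 can act on it nontrivially, and for Y
    of that degree Y X w = [Y, X] w because Y kills w. Now [primitive_zero]
    applies. *)
Lemma lower_zero X : in_g e1 e2 X -> hdeg (-1) X ->
  (forall f, gact (hbracket (hemb (gup 1 f)) X) w = 0) ->
  (forall f, gact (hbracket (hemb (glo 0 f)) X) w = 0) -> gact X w = 0.
Proof.
move=> gX dX hp hm.
have gu : gr (-1) (gact X w) by have := gr_act gX dX grw; rewrite addr0.
apply: (primitive_zero irrV grw w0 (k := -1)) => // i Y i0 gY dY.
have wk Z j : 0 < j -> in_g e1 e2 Z -> hdeg j Z -> gact Z w = 0 by apply: hw.2.
case: (eqVneq i 1) dY => [->|i1] dY; last first.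
  apply: (gr_pos irrV hw grw w0 (k := i - 1)); first by move: i1 => /eqP; lia.
  exact: gr_act.
have [f [g ->]] := @hdeg_odd _ _ _ 1 _ gY dY.
rewrite gactDl; [|exact: gE|exact: gE].
rewrite (gact_kill (k := 1)) //;
  [|exact: gE|exact: (hdeg_gup e1 e2 1 f)|by move=> *; apply: (wk _ 1)].
rewrite (gact_kill (k := 1)) //;
  [|exact: gE|exact: (hdeg_glo e1 e2 0 g)|by move=> *; apply: (wk _ 1)].
by rewrite hp hm addr0.
Qed.

Lemma kills_gup b : refl 0 b = (s1 0 * s2)%:P * b -> up_cond b -> forall f, kills (gup 0 (b * f)).
Proof.
move=> sb cb f; apply: lower_zero; [exact: gE|exact: (hdeg_gup e1 e2 0)| |] => g.
  by rewrite hbracket_up1_up0 gact0l.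
rewrite hbracket_lo0_up0 gact_gdiag upent_mul // mulrCA cb ?scale0r //.
by rewrite reflM refl_loent reflD reflK mulNr -mulrA [refl 0 f + f]addrC.
Qed.

Lemma kills_glo a : refl (-1) a = - ((s1 (-1) * s2)%:P * a) -> lo_cond a ->
  forall f, kills (glo (-1) (a * f)).
Proof.
move=> sa ca f; apply: lower_zero; [exact: gE|exact: (hdeg_glo e1 e2 (-1))| |] => g; last first.
  by rewrite hbracket_lo0_lo1 gact0l.
rewrite hbracket_up1_lo1.
have -> : (upent 1 g).[-1] * (loent (-1) (a * f)).[0] =
          (shp (-1) (upent 1 g) * loent (-1) (a * f)).[0].
  by rewrite hornerM horner_shp add0r.
rewrite odd_horner0; last first.
  by rewrite reflM refl_loent refl_shp_upent mulrN mulrACA -polyCM sgn12 mul1r.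
rewrite [gact _ _]gact_gdiag loent_mul // mulrCA ca ?scale0r //.
by rewrite reflM refl_shp_upent reflD reflK -mulrA [refl _ f + f]addrC.
Qed.

Let lam_eq0 f : dwt f *: w = 0 -> dwt f = 0.
Proof. by move=> /eqP; rewrite scaler_eq0 => /orP[/eqP|/eqP]. Qed.

Let lam2_eq0 f : dwt (f *+ 2) = 0 -> dwt f = 0.
Proof. by rewrite -scaler_nat lamZ => /eqP; rewrite scaler_eq0 pnatr_eq0 /= => /eqP. Qed.

Lemma up_cond_of_kills b : refl 0 b = (s1 0 * s2)%:P * b -> kills (gup 0 b) -> up_cond b.
Proof.
move=> sb kb q sq; do 2!apply: lam2_eq0; apply: lam_eq0; rewrite -gact_gdiag.
have -> : b * q *+ 2 *+ 2 = loent 0 q * upent 0 b.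
  by rewrite loent_sym // upent_sym // mulrnAr mulrnAl mulrC.
rewrite -hbracket_lo0_up0 -(gact_kill (k := 1)); [|exact: gE|exact: gE|exact: (hdeg_glo e1 e2 0)|].
  by rewrite [gact (hemb (gup 0 b)) w]kb gact0r //; apply: gE.
by move=> *; apply: (hw.2 1).
Qed.

Lemma lo_cond_of_kills a : refl (-1) a = - ((s1 (-1) * s2)%:P * a) ->
  kills (glo (-1) a) -> lo_cond a.
Proof.
move=> sa ka q sq; do 2!apply: lam2_eq0; apply: lam_eq0; rewrite -gact_gdiag.
pose f := shp 1 q.
have tf : upent 1 f = f *+ 2.
  apply: upent_sym; rewrite /f.
  have -> : refl 1 (shp 1 q) = refl 0 q by have := refl_shift 0 1 q; rewrite add0r.
  have -> : refl 0 q = shp 1 (refl (-1) q) by rewrite shp_refl subrr.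
  rewrite sq shpM shpC; congr ((_ * _)%:P * _); by case: e1; rewrite ?exprN1 ?invr1 ?invrN1.
have sf : shp (-1) (upent 1 f) = q *+ 2.
  by rewrite tf /shp rmorphMn /= -/(shp (-1) f) /f (shpK 1).
have E : a * q *+ 2 *+ 2 = shp (-1) (upent 1 f) * loent (-1) a.
  by rewrite sf loent_sym // mulrnAr mulrnAl mulrC.
have hE : hbracket (hemb (gup 1 f)) (hemb (glo (-1) a)) = hemb (gdiag 0 (a * q *+ 2 *+ 2)).
  rewrite hbracket_up1_lo1 -E; congr pair.
  have -> : (upent 1 f).[-1] * (loent (-1) a).[0] = (shp (-1) (upent 1 f) * loent (-1) a).[0].
    by rewrite hornerM horner_shp add0r.
  rewrite odd_horner0 //.
  by rewrite reflM refl_loent refl_shp_upent mulrN mulrACA -polyCM sgn12 mul1r.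
rewrite -hE -(gact_kill (k := 1)); [|exact: gE|exact: gE|exact: (hdeg_gup e1 e2 1)|].
  by rewrite [gact (hemb (glo (-1) a)) w]ka gact0r //; apply: gE.
by move=> *; apply: (hw.2 1).
Qed.

Lemma quasifinite_of_cond a b : a != 0 -> b != 0 ->
  refl (-1) a = - ((s1 (-1) * s2)%:P * a) -> refl 0 b = (s1 0 * s2)%:P * b ->
  lo_cond a -> up_cond b -> quasifinite V.
Proof.
move=> a0 b0 sa sb ca cb.
have [kk k0] := ideal_kills_all a0 b0 sa sb (kills_glo sa ca) (kills_gup sb cb).
have FD0 k : ideal_kills w (gdiag k) -> exists b, forall f, in_span b (gact (hemb (gdiag k f)) w).
  by apply: ideal_kills_FD => [c f g|f]; [rewrite gdiagD gdiagZ|apply: gE].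
have FDp k : ideal_kills w (gup k) -> exists b, forall f, in_span b (gact (hemb (gup k f)) w).
  by apply: ideal_kills_FD => [c f g|f]; [rewrite gupD gupZ|apply: gE].
have FDm k : ideal_kills w (glo k) -> exists b, forall f, in_span b (gact (hemb (glo k f)) w).
  by apply: ideal_kills_FD => [c f g|f]; [rewrite gloD gloZ|apply: gE].
have FDw : orbit_FD w.
  move=> j j0; have [k [jE|jE]] : exists k, j = k * 2 \/ j = k * 2 - 1.
    exists ((j + 1) %/ 2)%Z.
    by have := divz_eq (j + 1) 2; have := modz_ge0 (j + 1) (d := 2) isT;
       have := ltz_pmod (j + 1) (d := 2) isT; lia.
  - have k0' : k < 0 by lia.
    have [_ /FD0[bs hb] _] := kk k k0'; exists bs => _ [X [gX dX ->]].
    have [f ->] : exists f, X = hemb (gdiag k f).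
      by apply: hdeg_even => //; [lia|rewrite -jE].
    exact: hb.
  - have [/FDm[b1 h1] _ _] := kk (k - 1) ltac:(lia).
    have [b2 h2] : exists b, forall f, in_span b (gact (hemb (gup k f)) w).
      apply: FDp; have [->//|k'] := eqVneq k 0.
      by have [] := kk k ltac:(lia).
    exists (b1 ++ b2) => _ [X [gX dX ->]].
    have [f [g ->]] : exists f g, X = hemb (gup k f) + hemb (glo (k - 1) g).
      by apply: hdeg_odd => //; rewrite -jE.
    rewrite gactDl; [|exact: gE|exact: gE].
    by apply: in_spanD; [apply: in_span_catr|apply: in_span_catl].
move=> k; have [bs hb] := gr_FD irrV hw grw w0 FDw k; exists bs => v /hb.
by case/in_spanP => c ->; exists c.
Qed.

(** An infinite-dimensional family of elements of degree -1/2 has a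
    finite-dimensional image on w. *)
Lemma kernel_of_quasifinite (E : {poly K} -> SD K) :
  (forall a f g, E (a *: f + g) = a *: E f + E g) ->
  (forall f, in_g e1 e2 (hemb (E f)) /\ hdeg (-1) (hemb (E f))) ->
  quasifinite V -> exists2 f, f != 0 & kills (E f).
Proof.
move=> EL gE' /(_ (-1))[bs hb].
apply: (@FD_kernel _ _ (fun f => gact (hemb (E f)) w) _ bs) => [a f g|f].
  by rewrite EL hembD hembZ gact_linl //; apply: (gE' _).1.
apply/in_spanP; have [//|c ->] := hb (gact (hemb (E f)) w); last by exists c.
by have [gX dX] := gE' f; have := gr_act gX dX grw; rewrite addr0.
Qed.
End Module.
End Weight.

(** * Parity and generating series *)

Section Parity.
Variable K : numFieldType.
Implicit Types (p q f : {poly K}) (e : sgn).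

Definition has_parity e p := p \Po - 'X = (sgnv K e)%:P * p.

Lemma comp_polyNX p : p \Po - 'X = \poly_(i < size p) ((-1) ^+ i * p`_i).
Proof.
rewrite comp_polyE poly_def; apply: eq_bigr => i _.
by rewrite [(- 'X) ^+ i]exprNn -!mul_polyC polyCM polyC_exp polyCN polyC1; ring.
Qed.

Lemma has_parity_coef e p n : has_parity e p -> p`_n != 0 -> (-1) ^+ n = sgnv K e.
Proof.
move=> /(congr1 (fun q => q`_n)); rewrite comp_polyNX coef_poly mul_polyC poly.coefZ.
case: ltnP => [_|h]; last by rewrite nth_default ?eqxx.
by move=> /mulIf h /h.
Qed.

(** A linear and injective parametrization of the polynomials of parity e, by
    f(X^2) or f(X^2) X. *)
Definition par_poly e f := (f \Po 'X^2) * (if e is Minus then 'X else 1).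

Lemma par_poly_parity e f : has_parity e (par_poly e f).
Proof.
rewrite /has_parity /par_poly comp_polyM -comp_polyA comp_Xn_poly sqrrN.
by case: e; rewrite /= ?comp_polyC ?comp_polyX ?polyC1 ?mulr1 ?mul1r // mulrN polyCN mulNr mul1r.
Qed.

Lemma par_poly_neq0 e f : f != 0 -> par_poly e f != 0.
Proof.
move=> f0; rewrite mulf_neq0 //; last by case: e; rewrite ?oner_eq0 ?polyX_eq0.
by rewrite comp_poly_eq0 ?size_polyXn.
Qed.

Lemma par_polyL e a f g : par_poly e (a *: f + g) = a *: par_poly e f + par_poly e g.
Proof. by rewrite /par_poly comp_polyD comp_polyZ mulrDl scalerAl. Qed.
End Parity.

Section Series.
Variable K : numFieldType.
Implicit Types (p q f : {poly K}) (e : sgn) (a b : nat -> K).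

Lemma iter_fps_deriv a k n : iter k (@fps_deriv K) a n = (n + k)`!%:R / n`!%:R * a (n + k)%N.
Proof.
have nz m : m`!%:R != 0 :> K by rewrite pnatr_eq0 -lt0n fact_gt0.
elim: k n => [|k IH] n; first by rewrite addn0 divff ?mul1r.
rewrite iterS /fps_deriv IH addSn addnS mulrA; congr (_ * _).
by rewrite mulrCA [n.+1`!]factS natrM invfM [n.+1%:R * _]mulrA divff ?mul1r ?pnatr_eq0.
Qed.

Lemma fps_diffopE p a n :
  fps_diffop p a n = \sum_(k < size p) p`_k * ((n + k)`!%:R / n`!%:R * a (n + k)%N).
Proof. by apply: eq_bigr => k _; rewrite iter_fps_deriv. Qed.

Lemma fps_diffopD p a b n : fps_diffop p a n + fps_diffop p b n = fps_diffop p (a \+ b) n.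
Proof. by rewrite !fps_diffopE -big_split; apply: eq_bigr => k _ /=; rewrite !mulrDr. Qed.

Lemma eq_fps_diffop p a b n : a =1 b -> fps_diffop p a n = fps_diffop p b n.
Proof. by move=> h; rewrite !fps_diffopE; apply: eq_bigr => k _; rewrite h. Qed.

Section Odd.
Variable L : {poly K} -> K^o.
Hypothesis LL : forall (c : K) f g, L (c *: f + g) = c *: L f + L g.
Variable y : {poly K}.

(** The series of L(sinh(x y)) in x. *)
Definition odd_series n : K := if odd n then L (y ^+ n) / n`!%:R else 0.

Lemma diffop_odd_series p n : fps_diffop p odd_series n =
  (\sum_(k < size p) p`_k * (if odd (n + k) then L (y ^+ (n + k)) : K else 0)) / n`!%:R.
Proof.
rewrite fps_diffopE mulr_suml; apply: eq_bigr => k _; rewrite -[RHS]mulrA; congr (_ * _).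
rewrite /odd_series; case: ifP => _; last by rewrite mulr0 mul0r.
by rewrite mulrC -mulrA; congr (_ * _); rewrite mulrA mulVf ?mul1r // pnatr_eq0 -lt0n fact_gt0.
Qed.

(** In p(d/dx) sinh(x y) only the derivatives of one parity occur, so half of the
    coefficients are zero. *)
Lemma diffop_odd_series_same e p n : has_parity e p -> (-1) ^+ n = sgnv K e ->
  fps_diffop p odd_series n = 0.
Proof.
move=> hp hn; rewrite diffop_odd_series big1 ?mul0r // => k _.
have [->|nz] := eqVneq p`_k 0; first by rewrite mul0r.
have := has_parity_coef hp nz; rewrite -hn oddD -(signr_odd _ k) -(signr_odd _ n).
case: (odd k); case: (odd n) => //=; rewrite ?expr0 ?expr1 ?mulr0 // => /eqP.
  by rewrite -subr_eq0 -opprD oppr_eq0 -mulr2n pnatr_eq0.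
by rewrite -subr_eq0 opprK -mulr2n pnatr_eq0.
Qed.

Lemma diffop_odd_series_diff e p n : has_parity e p -> (-1) ^+ n = - sgnv K e ->
  fps_diffop p odd_series n = L ((p * 'X^n) \Po y) / n`!%:R.
Proof.
move=> hp hn; rewrite diffop_odd_series; congr (_ / _).
have -> : (p * 'X^n) \Po y = \sum_(k < size p) p`_k *: y ^+ (n + k).
  rewrite comp_polyM comp_Xn_poly comp_polyE mulr_suml; apply: eq_bigr => k _.
  by rewrite addnC exprD scalerAl.
rewrite (polymap_sum LL); apply: eq_bigr => k _; rewrite (polymapZ LL).
have [->|nz] := eqVneq p`_k 0; first by rewrite mul0r scale0r.
have := has_parity_coef hp nz; move: hn; rewrite oddD -(signr_odd _ k) -(signr_odd _ n).
move=> hn hk; have : (-1) ^+ odd n = - (-1) ^+ odd k :> K by rewrite hn hk.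
case: (odd k); case: (odd n) => //=; rewrite ?expr0 ?expr1 ?opprK => /eqP.
  by rewrite -subr_eq0 -opprD oppr_eq0 -mulr2n pnatr_eq0.
by rewrite -subr_eq0 opprK -mulr2n pnatr_eq0.
Qed.

(** L kills the multiples of p(y) by polynomials in y of the parity opposite to
    that of p. *)
Definition annihilates e p := forall q, q \Po - 'X = - ((sgnv K e)%:P * q) -> L ((p * q) \Po y) = 0.

(** If p is even then p(d/dx) sinh(x y) = p(y) sinh(x y), and if p is odd it is
    p(y) cosh(x y); the coefficients of these series are multiples of p(y) y^n
    with n of the parity opposite to p. *)
Lemma diffop_odd_seriesP e p : has_parity e p ->
  (forall n, fps_diffop p odd_series n = 0) <-> annihilates e p.
Proof.
move=> hp; split=> [h q hq|h n].
  have qc n : q`_n != 0 -> (-1) ^+ n = - sgnv K e.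
    have : has_parity (if e is Plus then Minus else Plus) q.
      rewrite /has_parity hq -mulNr -polyCN; congr (_%:P * _); case: e {hp hq} => //=.
      by rewrite opprK.
    by move=> /has_parity_coef hc /hc ->; case: e {hp hq hc} => //=; rewrite opprK.
  have -> : p * q = \sum_(n < size q) q`_n *: (p * 'X^n).
    by rewrite -{1}[q]coefK poly_def mulr_sumr; apply: eq_bigr => n _; rewrite scalerAr.
  rewrite (raddf_sum (comp_poly y)) (polymap_sum LL) big1 // => n _ /=.
  rewrite comp_polyZ (polymapZ LL).
  have [->|/qc hn] := eqVneq q`_n 0; first by rewrite scale0r.
  have := h n; rewrite (diffop_odd_series_diff hp hn) => /eqP.
  rewrite mulf_eq0 invr_eq0 pnatr_eq0 -leqn0 leqNgt fact_gt0 orbF => /eqP ->.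
  by rewrite scaler0.
have [hn|hn] : (-1) ^+ n = sgnv K e \/ (-1) ^+ n = - sgnv K e.
  rewrite -signr_odd; case: (odd n); case: e {hp h};
    by rewrite /= ?expr0 ?expr1 ?opprK; by [left|right].
  exact: diffop_odd_series_same hp hn.
rewrite (diffop_odd_series_diff hp hn) h ?mul0r //.
by rewrite comp_Xn_poly -[RHS]mulNr -polyCN -hn polyC_exp polyCN polyC1 -exprNn.
Qed.
End Odd.
End Series.

Section Characterization.
Variables (K : numFieldType) (e1 e2 : sgn) (xi : SDhat K -> K).
Implicit Types (p q f : {poly K}) (n : nat).
Hypothesis wxi : weight e1 e2 xi.
Local Notation gdiag := (@gdiag K e1 e2).
Local Notation dwt := (@dwt K e1 e2 xi).
Let LL := dwt_lin wxi.
Local Notation u := ('X + (2%:R^-1)%:P : {poly K}).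

(** The sign - e1 e2, which is the parity of the polynomials below the diagonal in
    degree -1/2. *)
Definition sgn_m : sgn := match e1, e2 with Plus, Plus | Minus, Minus => Minus | _, _ => Plus end.

Lemma sgn_mE r : r = 1 \/ r = -1 -> sgnv K e1 ^ r * sgnv K e2 = - sgnv K sgn_m.
Proof.
rewrite /sgn_m; case: e1; case: e2; case=> ->;
  by rewrite /= ?exprN1 ?invr1 ?invrN1 ?mulr1 ?mul1r ?mulrNN ?mulr1 ?opprK.
Qed.

Lemma parity_conditionE (alpha beta : {poly K}) :
  parity_condition e1 e2 alpha beta <-> has_parity sgn_m alpha /\ has_parity e2 beta.
Proof.
have P p : has_parity Plus p <-> even_poly p by rewrite /has_parity /= polyC1 mul1r.
have M p : has_parity Minus p <-> odd_poly p by rewrite /has_parity /= polyCN mulNr mul1r.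
by rewrite /sgn_m; case: e1; case: e2 => /=; rewrite ?P ?M.
Qed.

Lemma half2 : 2%:R^-1 + 2%:R^-1 = 1 :> K.
Proof. by rewrite -mulr2n -[_ *+ 2]mulr_natr mulVf // pnatr_eq0. Qed.

(** The reflection w |-> - w - 1 is u |-> - u. *)
Lemma refl0_u p : refl 0 (p \Po u) = (p \Po - 'X) \Po u.
Proof.
rewrite /refl -!comp_polyA; congr (_ \Po _).
have h1 : (0 + 1)%:~R = (2%:R^-1)%:P + (2%:R^-1)%:P :> {poly K}.
  by rewrite -polyCD half2 add0r.
by rewrite comp_polyD comp_polyX comp_polyC h1 rmorphN /= comp_polyX; ring.
Qed.

Lemma comp_uK p : (p \Po u) \Po ('X - (2%:R^-1)%:P) = p.
Proof. by rewrite -comp_polyA comp_polyD comp_polyX comp_polyC subrK comp_polyXr. Qed.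
Lemma comp_uVK p : (p \Po ('X - (2%:R^-1)%:P)) \Po u = p.
Proof. by rewrite -comp_polyA comp_polyB comp_polyX comp_polyC addrK comp_polyXr. Qed.

Lemma reflm1 p : refl (-1) p = p \Po - 'X.
Proof. by rewrite /refl addNr subr0. Qed.

Lemma refl_m_parity p :
  has_parity sgn_m p <-> refl (-1) p = - ((sgnv K e1 ^ (-1) * sgnv K e2)%:P * p).
Proof. by rewrite reflm1 sgn_mE; [rewrite polyCN mulNr opprK|right]. Qed.

Lemma refl_p_parity p : has_parity e2 p ->
  refl 0 (p \Po u) = (sgnv K e1 ^ 0 * sgnv K e2)%:P * (p \Po u).
Proof. by rewrite refl0_u expr0z mul1r => ->; rewrite comp_polyM comp_polyC. Qed.

Lemma up_condP p : up_cond e1 e2 xi (p \Po u) <-> annihilates dwt u e2 p.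
Proof.
rewrite /up_cond /annihilates expr0z mul1r; split=> h q hq.
  rewrite comp_polyM; apply: h; rewrite refl0_u hq.
  by rewrite rmorphN /= comp_polyM comp_polyC.
rewrite -(comp_uVK q) -comp_polyM; apply: h.
apply: (can_inj comp_uK); rewrite -refl0_u comp_uVK hq rmorphN /= comp_polyM comp_polyC.
by rewrite comp_uVK.
Qed.

Lemma lo_condP p : lo_cond e1 e2 xi p <-> annihilates dwt 'X sgn_m p.
Proof.
rewrite /lo_cond /annihilates sgn_mE; last by right.
split=> h q hq; first by rewrite comp_polyXr; apply: h; rewrite reflm1 hq polyCN mulNr.
by rewrite -[_ * _]comp_polyXr; apply: h; rewrite -reflm1 hq polyCN mulNr.
Qed.

Lemma xi_polD f : refl 0 f = - f -> xi (hemb (polD f)) = dwt f.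
Proof.
move=> hf; congr (xi (hemb _)); rewrite /polD gdiagE expr0z mul1r hf scaleNr opprK.
by congr (mono _ _); apply: mx2P; rewrite !mxE /=; ring.
Qed.

Lemma xi_diff f : refl 0 f = f ->
  xi (hemb ((theta K * dtheta K - dtheta K * theta K) * polD f)) = - dwt f.
Proof.
move=> hf; rewrite -[RHS]scaleN1r -(polymapZ LL) scaleN1r; congr (xi (hemb _)).
rewrite /theta /dtheta !mono_mul -monoN -monoD /polD !mono_mul gdiagE expr0z mul1r reflN hf.
rewrite !shift_id !addr0 !mul_delta_mx; congr (mono _ _).
by apply: mx2P; rewrite mulmx2 !mxE /=; ring.
Qed.

Lemma refl0_uX n : refl 0 (u ^+ n) = (-1) ^+ n * u ^+ n.
Proof.
rewrite -[X in refl 0 X]comp_Xn_poly refl0_u comp_Xn_poly [LHS](rmorphXn (comp_poly u)) /=.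
by rewrite rmorphN /= comp_polyX [LHS]exprNn.
Qed.

Lemma Delta0E n : Delta0 xi n = - odd_series dwt u n.
Proof.
rewrite /Delta0 /odd_series /sinh_coef xi_polD.
  case: ifP => _; last by rewrite (polymap0 LL).
  by rewrite (polymapZ LL) mulrC.
case: ifP => on; last by rewrite refl0 oppr0.
by rewrite -mul_polyC reflM reflC refl0_uX -signr_odd on expr1 mulN1r mulrN.
Qed.

Lemma Delta1E n : Delta1 xi n = if odd n then 0 else dwt (u ^+ n) / n`!%:R.
Proof.
rewrite /Delta1 /cosh_coef xi_diff ?opprK.
  case: ifP => _; first by rewrite (polymap0 LL).
  by rewrite (polymapZ LL) mulrC.
case: ifP => on; first by rewrite refl0.
by rewrite -mul_polyC reflM reflC refl0_uX -signr_odd on expr0 mul1r.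
Qed.

Let fact_neq0 n : n`!%:R != 0 :> K.
Proof. by rewrite pnatr_eq0 -lt0n fact_gt0. Qed.

(** The binomial theorem for w = u - 1/2. *)
Lemma dwt_shift n : dwt ('X ^+ n) / n`!%:R =
  \sum_(i < n.+1) fps_exp (- 2%:R^-1) i * (dwt (u ^+ (n - i)) / (n - i)`!%:R).
Proof.
have -> : 'X ^+ n = (u + (- 2%:R^-1)%:P) ^+ n by rewrite polyCN addrK.
rewrite exprDn (polymap_sum LL) mulr_suml; apply: eq_bigr => i _.
rewrite -polyC_exp [_ ^+ _ * _]mulrC mul_polyC -scaler_nat !(polymapZ LL) /fps_exp.
have /(congr1 (fun m => m%:R : K)) : ('C(n, i) * (i`! * (n - i)`!))%N = n`!.
  by rewrite bin_fact // -ltnS.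
rewrite !natrM => <-.
have C0 : 'C(n, i)%:R != 0 :> K by rewrite pnatr_eq0 -lt0n bin_gt0 -ltnS.
have key (A B C D E : K) : C != 0 -> D != 0 -> E != 0 ->
    C * (A * B) / (C * (D * E)) = A / D * (B / E).
  by move=> C' D' E'; field; rewrite C' D' E'.
exact: key.
Qed.

(** By the addition formulas, 2 cosh(x/2) sinh(x u) is
    sinh(x (w + 1)) + sinh(x w), and 2 sinh(x/2) cosh(x u) is
    sinh(x (w + 1)) - sinh(x w). Coefficientwise, each term of either product
    equals up to sign a term of the binomial expansion of [dwt_shift]. *)
Lemma second_series n :
  fps_mul (fps_exp 2%:R^-1 \+ fps_exp (- 2%:R^-1)) (Delta0 xi) n +
  fps_mul (fps_exp 2%:R^-1 \- fps_exp (- 2%:R^-1)) (Delta1 xi) n =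
  - 2%:R * odd_series dwt 'X n.
Proof.
rewrite /fps_mul -big_split /= /odd_series.
have eN i : fps_exp (- 2%:R^-1) i = (-1) ^+ odd i * fps_exp 2%:R^-1 i :> K.
  by rewrite /fps_exp signr_odd [(- _^-1) ^+ i]exprNn mulrA.
case: ifP => on.
  rewrite dwt_shift mulr_sumr; apply: eq_bigr => i _.
  rewrite Delta0E Delta1E /odd_series eN oddB ?on /=; last by rewrite -ltnS.
  by case: (odd i); rewrite /= ?expr0 ?expr1; ring.
rewrite mulr0 big1 // => i _.
rewrite Delta0E Delta1E /odd_series eN oddB ?on /=; last by rewrite -ltnS.
by case: (odd i); rewrite /= ?expr0 ?expr1; ring.
Qed.

Lemma first_condition (beta : {poly K}) : has_parity e2 beta ->
  (forall n, fps_diffop beta (Delta0 xi) n = 0) <-> annihilates dwt u e2 beta.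
Proof.
move=> hb; rewrite -(diffop_odd_seriesP LL u hb).
have E n : fps_diffop beta (Delta0 xi) n = - fps_diffop beta (odd_series dwt u) n.
  rewrite !fps_diffopE -sumrN; apply: eq_bigr => k _; by rewrite Delta0E !mulrN.
by split=> h n; [apply/eqP; rewrite -oppr_eq0 -E h|rewrite E h oppr0].
Qed.

Lemma second_condition (alpha : {poly K}) (c : K) n :
  fps_diffop alpha
    (fps_mul (fps_exp 2%:R^-1 \+ fps_exp (- 2%:R^-1)) (Delta0 xi)) n +
  fps_diffop alpha
    (fps_mul (fps_exp 2%:R^-1 \- fps_exp (- 2%:R^-1)) (Delta1 xi) \- fps_const (2%:R * c)) n
  = - 2%:R * fps_diffop alpha (odd_series dwt 'X) n - (if n is 0 then alpha`_0 * (2%:R * c) else 0).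
Proof.
rewrite fps_diffopD.
rewrite (@eq_fps_diffop _ _ _
  (fun m => - 2%:R * odd_series dwt 'X m + - fps_const (2%:R * c) m)); last first.
  by move=> m /=; rewrite addrA second_series.
rewrite -fps_diffopD; congr (_ + _).
  rewrite !fps_diffopE mulr_sumr; apply: eq_bigr => k _; ring.
rewrite fps_diffopE; case: n => [|n]; last first.
  by rewrite big1 ?oppr0 // => k _; rewrite /fps_const addSn oppr0 !mulr0.
have [->|a0] := eqVneq alpha 0; first by rewrite size_poly0 big_ord0 poly.coef0 mul0r oppr0.
move: a0; rewrite -size_poly_gt0; case: (size alpha) => // m _.
rewrite big_ord_recl /= big1 ?addr0.
  by rewrite addn0 divff ?oner_eq0 // mul1r mulrN.
by move=> i _; rewrite /fps_const /bump /= add0n oppr0 !mulr0.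
Qed.
End Characterization.

(** * The characterization *)

Section Final.
Variables (K : numFieldType) (e1 e2 : sgn) (xi : SDhat K -> K) (L : graded_gmodule K e1 e2).
Hypothesis wxi : weight e1 e2 xi.
Let LL := dwt_lin wxi.
Local Notation u := ('X + (2%:R^-1)%:P : {poly K}).
Local Notation dwt := (@dwt K e1 e2 xi).

(** If the generator of the induced module were sent to 0, then the projection and
    the zero map would be two morphisms from the induced module with the same
    value at the generator, so L would be zero. *)
Lemma irr_highest_vector : irr_highest_weight xi L ->
  irreducible_gmodule L /\ exists w : L, [/\ highest_vector xi w, gr 0 w & w <> 0].
Proof.
case=> M [v [pi [[hv ind] grv [piL piA] [pigr pis] irr]]]; split=> //.
have pi0 : pi 0 = 0.
  by have := piL (-1) 0 0; rewrite scaler0 addr0 scaleN1r addNr.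
have piZ a x : pi (a *: x) = a *: pi x by have := piL a x 0; rewrite pi0 !addr0.
exists (pi v); split; [split|exact: pigr|].
- by move=> x gx dx; rewrite -piA // hv.1 // piZ.
- by move=> k x k0 gx dx; rewrite -piA // (hv.2 k) // pi0.
move=> pv0; have h0 : highest_vector xi (0 : L).
  split=> [x gx dx|k x k0 gx dx]; by rewrite gact0r // scaler0.
have [f [_ _ funiq]] := ind L 0 h0.
have pif : pi =1 f by apply: funiq.
have zf : (fun _ => 0) =1 f.
  by apply: funiq => //; split=> [a x y|x y gx]; rewrite ?scaler0 ?addr0 // gact0r.
case: irr => -[l l0] _; apply: l0; have [x <-] := pis l.
by rewrite pif -zf.
Qed.

Theorem quasifinite_iff : irr_highest_weight xi L ->
  let c := xi (central K) in
  quasifinite L <->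
  exists alpha beta : {poly K},
    [/\ alpha != 0, beta != 0, parity_condition e1 e2 alpha beta,
        forall n, fps_diffop beta (Delta0 xi) n = 0
      & forall n,
          fps_diffop alpha
            (fps_mul (fps_exp 2%:R^-1 \+ fps_exp (- 2%:R^-1)) (Delta0 xi)) n +
          fps_diffop alpha
            (fps_mul (fps_exp 2%:R^-1 \- fps_exp (- 2%:R^-1)) (Delta1 xi)
             \- fps_const (2%:R * c)) n = 0].
Proof.
move=> /irr_highest_vector[irr [w [hw grw w0]]] c; split=> [qf|].
  have [f f0 kf] : exists2 f, f != 0 & kills w (glo e1 e2 (-1) (par_poly (sgn_m e1 e2) f)).
    apply: (kernel_of_quasifinite grw _ _ qf) => [a f g|f].
      by rewrite par_polyL gloD gloZ.
    by split; [apply: in_g_skew|apply: (hdeg_glo e1 e2 (-1))].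
  have [g g0 kg] : exists2 g, g != 0 & kills w (gup e1 e2 0 (par_poly e2 g \Po u)).
    apply: (kernel_of_quasifinite grw _ _ qf) => [a f' g|g].
      by rewrite par_polyL comp_polyD comp_polyZ gupD gupZ.
    by split; [apply: in_g_skew|apply: (hdeg_gup e1 e2 0)].
  (* 'X * f instead of f multiplies alpha by 'X^2, which removes the constant
     term of the second equation and keeps the parity. *)
  pose alpha := par_poly (sgn_m e1 e2) ('X * f).
  have pa0 := par_poly_parity (sgn_m e1 e2) f.
  have pa : has_parity (sgn_m e1 e2) alpha := par_poly_parity _ _.
  have pb := par_poly_parity e2 g.
  exists alpha, (par_poly e2 g); split.
  - by rewrite par_poly_neq0 // mulf_neq0 ?polyX_eq0.
  - exact: par_poly_neq0.
  - by apply/parity_conditionE.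
  - apply/(first_condition wxi pb)/up_condP/(up_cond_of_kills wxi hw w0 _ kg).
    exact: refl_p_parity.
  have /(lo_condP e1 e2 xi) an : lo_cond e1 e2 xi (par_poly (sgn_m e1 e2) f).
    by apply: (lo_cond_of_kills wxi hw w0 _ kf); apply/refl_m_parity.
  have /(diffop_odd_seriesP LL 'X pa) ann : annihilates dwt 'X (sgn_m e1 e2) alpha.
    move=> q hq; have -> : alpha * q = par_poly (sgn_m e1 e2) f * ('X^2 * q).
      by rewrite /alpha /par_poly comp_polyM comp_polyX; ring.
    apply: an; rewrite comp_polyM comp_Xn_poly sqrrN hq; ring.
  move=> n; rewrite (second_condition wxi) ann mulr0 sub0r.
  case: n => [|n]; rewrite ?oppr0 //.
  have -> : alpha`_0 = 0.
    by rewrite /alpha /par_poly comp_polyM comp_polyX -mulrA coefXnM.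
  by rewrite mul0r oppr0.
case=> alpha [beta [a0 b0 /parity_conditionE[pa pb] hb ha]].
have b0' : beta \Po u != 0 by rewrite comp_poly2_eq0 // size_XaddC.
apply: (quasifinite_of_cond irr hw grw w0 (a := alpha) (b := beta \Po u)) => //.
- exact/refl_m_parity.
- exact: refl_p_parity.
- apply/lo_condP/(diffop_odd_seriesP LL 'X pa) => n.
  have := ha n; rewrite (second_condition wxi).
  have two : - 2%:R != 0 :> K by rewrite oppr_eq0 pnatr_eq0.
  case: n => [|n]; last by rewrite subr0 => /eqP; rewrite mulf_eq0 (negPf two) => /eqP.
  (* The constant 2c can only matter if alpha`_0 != 0, and then alpha is even. *)
  move=> h; have [z|nz] := eqVneq alpha`_0 0.
    by move: h; rewrite z mul0r subr0 => /eqP; rewrite mulf_eq0 (negPf two) => /eqP.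
  exact: diffop_odd_series_same pa (has_parity_coef pa nz).
- by apply/up_condP/(first_condition wxi pb).
Qed.
End Final.

Theorem theorem5p2 (R : realType) (e1 e2 : sgn) (xi : SDhat R[i] -> R[i])
    (L : graded_gmodule R[i] e1 e2) :
  weight e1 e2 xi -> irr_highest_weight xi L ->
  let c := xi (central R[i]) in
  quasifinite L <->
  exists alpha beta : {poly R[i]},
    [/\ alpha != 0, beta != 0, parity_condition e1 e2 alpha beta,
        forall n, fps_diffop beta (Delta0 xi) n = 0
      & forall n,
          fps_diffop alpha
            (fps_mul (fps_exp 2%:R^-1 \+ fps_exp (- 2%:R^-1)) (Delta0 xi)) n +
          fps_diffop alpha
            (fps_mul (fps_exp 2%:R^-1 \- fps_exp (- 2%:R^-1)) (Delta1 xi)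
             \- fps_const (2%:R * c)) n = 0].
Proof. exact: quasifinite_iff. Qed.
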